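(* Let $p$ be an arbitrary prime. There exists an infinite, finitely generated, recursively presented, residually finite group $G$ such that all finite Cartesian powers of $G$ are algorithmically finite, i.e., for every positive integer $n$ there is no algorithm that writes out an infinite sequence of pairwise different elements of the group $G^n$. Moreover, $G$ can be chosen (still infinite, finitely generated, recursively presented, residually finite, and with all finite Cartesian powers $G^n$ algorithmically finite) so that it contains a normal subgroup $N$ isomorphic to an infinite direct power $\bigoplus_{i=1}^{\infty}\mathbb{Z}_p$ of the cyclic group $\mathbb{Z}_p$ of order $p$, and the corresponding extension splits: $G = H \ltimes N$ for some subgroup $H \le G$.
   Context: A finitely generated group is recursively presented if it has a presentation $\langle X \mid R\rangle$ with $X$ finite and $R$ a recursively enumerable set of words in $X^{\pm1}$. For a group $G$ generated by a finite set $X$, elements of $G^n$ are represented by $n$-tuples of words in $X^{\pm 1}$. A finitely generated group $K$ (here $K=G^n$) is algorithmically finite if there is no algorithm (a programme with no input) that writes out an infinite sequence of words (for $G^n$: an infinite sequence of $n$-tuples of words in $X^{\pm1}$) representing pairwise different elements of the group. Here $\bigoplus_{i=1}^\infty \mathbb{Z}_p$ denotes the restricted direct product (direct sum) of countably infinitely many copies of $\mathbb{Z}_p$. The notation $G=H\ltimes N$ means that $G$ is the (internal) semidirect product of the normal subgroup $N$ and the subgroup $H$, i.e. $G=HN$ and $H\cap N=\{1\}$. *)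

(* Defs.v *)
From HB Require Import structures.
From mathcomp Require Import all_boot all_order all_algebra all_fingroup.
From mathcomp Require Import classical_sets functions cardinality.

Set Implicit Arguments.
Unset Strict Implicit.
Unset Printing Implicit Defensive.

(** * Partial recursive functions *)

(* Syntax of mu-recursive functions on tuples of natural numbers.  Arities are
   not tracked: arguments form a list, and a missing argument reads as 0. *)
Inductive recfun : Type :=
  | Zero
  | Succ
  | Proj of nat
  | Comp of recfun & seq recfun
  | PRec of recfun & recfun
  | Mu of recfun.

(* [computes f v y]: the program f halts on the arguments v with output y.
   - Comp g [:: h1; ..; hk] : v |-> g (h1 v, .., hk v)
   - F = PRec g h : F (0, v) = g v  and  F (n+1, v) = h (n, F (n, v), v)
   - Mu g : v |-> the least y with g (y, v) = 0, provided that g (i, v) is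
     defined (and nonzero) for all i < y. *)
Fixpoint computes (f : recfun) (v : seq nat) (y : nat) {struct f} : Prop :=
  match f with
  | Zero => y = 0
  | Succ => y = (nth 0 v 0).+1
  | Proj i => y = nth 0 v i
  | Comp g hs =>
      exists2 ws : seq nat,
        (fix computes_all (hs : seq recfun) (ws : seq nat) : Prop :=
           match hs, ws with
           | [::], [::] => True
           | h :: hs', w :: ws' => computes h v w /\ computes_all hs' ws'
           | _, _ => False
           end) hs ws
        & computes g ws y
  | PRec g h =>
      (fix prec (n y : nat) : Prop :=
         if n is n'.+1
         then exists2 z, prec n' z & computes h [:: n', z & behead v] y
         else computes g (behead v) y) (head 0 v) y
  | Mu g =>
      computes g (y :: v) 0 /\
      forall i, i < y -> exists z, computes g (i :: v) z.+1
  end.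

(** * Words in the generators and their inverses *)

(* The letter (i, false) is the i-th generator, (i, true) is its inverse. *)
Definition letter (m : nat) : Type := ('I_m * bool)%type.
Definition word (m : nat) : Type := seq (letter m).

Definition inv_letter m (l : letter m) : letter m := (l.1, ~~ l.2).

Definition letter_code m (l : letter m) : nat := (l.1 : nat).*2 + l.2.
Definition word_code m (w : word m) : nat :=
  CodeSeq.code (map (@letter_code m) w).
Definition words_code m n (t : n.-tuple (word m)) : nat :=
  CodeSeq.code (map (@word_code m) t).

(* R is the domain of a partial recursive function. *)
Definition recursively_enumerable m (R : word m -> Prop) : Prop :=
  exists f : recfun, forall w, R w <-> exists y, computes f [:: word_code w] y.

(** * Group-theoretic notions, for possibly infinite groups *)

Section Groups.
Local Open Scope group_scope.

Variable G : groupType.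

Definition word_val m (x : 'I_m -> G) (w : word m) : G :=
  \prod_(l <- w) (if l.2 then (x l.1)^-1 else x l.1).

Definition generates m (x : 'I_m -> G) : Prop :=
  forall g, exists w, word_val x w = g.

Definition finitely_generated : Prop :=
  exists m (x : 'I_m -> G), generates x.

(* The congruence on words whose quotient is the group < x_1, .., x_m | R >. *)
Inductive rel_equiv m (R : word m -> Prop) : word m -> word m -> Prop :=
  | RelRefl w : rel_equiv R w w
  | RelSym w1 w2 : rel_equiv R w1 w2 -> rel_equiv R w2 w1
  | RelTrans w1 w2 w3 :
      rel_equiv R w1 w2 -> rel_equiv R w2 w3 -> rel_equiv R w1 w3
  | RelCancel u v l : rel_equiv R (u ++ [:: l; inv_letter l] ++ v) (u ++ v)
  | RelRelator u v r : R r -> rel_equiv R (u ++ r ++ v) (u ++ v).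

(* The map sending the i-th generator to x i induces an isomorphism from
   < x_1, .., x_m | R > onto G. *)
Definition presented_by m (x : 'I_m -> G) (R : word m -> Prop) : Prop :=
  generates x /\
  forall w1 w2, word_val x w1 = word_val x w2 <-> rel_equiv R w1 w2.

Definition recursively_presented : Prop :=
  exists m (x : 'I_m -> G) (R : word m -> Prop),
    recursively_enumerable R /\ presented_by x R.

Definition residually_finite : Prop :=
  forall g : G, g <> 1 ->
  exists (Q : finGroupType) (f : {multiplicative G -> Q}), f g <> 1.

(* The element of the Cartesian power G^n represented by a tuple of words. *)
Definition words_val m n (x : 'I_m -> G) (t : n.-tuple (word m)) :
    {ffun 'I_n -> G} :=
  [ffun k => word_val x (tnth t k)].

(* Algorithmic finiteness of G^n.  A programme without input writing an
   infinite sequence is a total recursive function i |-> (i-th item written);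
   the items are tuples of words in an arbitrary finite generating family. *)
Definition power_algorithmically_finite (n : nat) : Prop :=
  forall m (x : 'I_m -> G), generates x ->
  ~ exists (f : recfun) (s : nat -> n.-tuple (word m)),
      (forall i, computes f [:: i] (words_code (s i))) /\
      (forall i j, i <> j -> words_val x (s i) <> words_val x (s j)).

Definition normal_subgroup (N : {pred G}) : Prop :=
  group_closed N /\ forall u g, u \in N -> u ^ g \in N.

(* G = H |>< N, internally *)
Definition internal_semidirect_product (H N : {pred G}) : Prop :=
  [/\ group_closed H, normal_subgroup N,
      forall g, exists h u, [/\ h \in H, u \in N & g = h * u]
    & forall g, g \in H -> g \in N -> g = 1].

(* N is isomorphic to the direct sum of countably many copies of Z_p, i.e. to
   the additive group of finitely supported functions nat -> Z_p.  Only
   meaningful for p > 1 because of the convention on 'Z_0 and 'Z_1. *)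
Definition iso_direct_sum_Zp (p : nat) (N : {pred G}) : Prop :=
  let D : set (nat -> 'Z_p) := [set a | finite_set [set i | a i <> 0%R]]%classic
  in exists phi : (nat -> 'Z_p) -> G,
    set_bij D [set` N]%classic phi /\
    forall a b, D a -> D b -> phi (fun i => a i + b i)%R = phi a * phi b.

Definition infinite_rp_rf_powers_alg_finite : Prop :=
  [/\ infinite_set [set: G]%classic,
      finitely_generated,
      recursively_presented,
      residually_finite
    & forall n, 0 < n -> power_algorithmically_finite n].

End Groups.

(* Main.v *)
Require Import Defs.
From HB Require Import structures.
From mathcomp Require Import all_boot all_order all_algebra all_fingroup.
From mathcomp Require Import boolp classical_sets functions cardinality.
From mathcomp Require Import zify ring.

Set Implicit Arguments.
Unset Strict Implicit.
Unset Printing Implicit Defensive.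

(* The group is a semidirect product H |>< N built from a graded algebra
   A = F_p<x_1, .., x_8> / I: H is generated by the units 1 + x_i (the squares
   x_i^2 lie in I), and N is the additive group of A, on which H acts by right
   multiplication; N is generated as an H-group by one element t, so G is
   generated by t and the 1 + x_i.  A word in these letters is evaluated in the
   free algebra on t, x_1, .., x_8, keeping only the coefficients at monomials
   of the form u or t u with u free of t.

   The ideal I kills every algorithm.  For the e-th programme (together with a
   number n of components and a table of words to substitute for the letters of
   its output) wait until it writes two n-tuples whose values agree in all
   degrees below e + 2; such a pair exists if the programme is total, by the
   pigeonhole principle.  The homogeneous components of the difference of the
   first such pair are added to I, so the two tuples become equal in G^n.  Since
   I is homogeneous, G is residually finite; since the choice of pairs is
   semi-decidable, G is recursively presented.  Programme e contributes at most
   2 n <= 2 e relators in each degree, and none below degree e + 2, hence there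
   are at most (d - 1)(d - 2) relators of degree d besides the eight squares, and
   the Golod-Shafarevich inequality shows that A is infinite-dimensional. *)

(** * Total recursive functions of natural numbers *)

(** The programmes must be listed before G exists, yet algorithmic finiteness concerns words in an
    arbitrary generating family of G. The table in the index breaks this circle: every finite table
    occurs, among them the one that rewrites the given generators as words in the standard ones.
    Storing n in the index lets one group serve all powers, and n <= e holds because the code of a
    pair bounds its entries. Totality of a programme is undecidable, but nothing has to be decided:
    a programme that never yields a pair contributes no relator. The selected pair must be unique,
    for the count, and enumerable, for the presentation; uniformization of a semi-decidable relation
    gives both. Monomials with t in a later position span an ideal, so dropping them imposes x_i t =
    t t = 0. Values then have the form a + t b and multiply like affine maps, (a + t b)(c + t d) = a
    c + t (b c + d), since a has constant term 1. The squares in I make 1 - x_i inverse to 1 + x_i,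
    so every word has a polynomial value and no power series occur. *)

Definition computes_all (v : seq nat) :=
  fix computes_all (hs : seq recfun) (ws : seq nat) : Prop :=
    match hs, ws with
    | [::], [::] => True
    | h :: hs', w :: ws' => computes h v w /\ computes_all hs' ws'
    | _, _ => False
    end.

(** Holds by conversion: [computes_all] repeats the anonymous fixpoint inside [computes] and gives
    it a name for inductions. *)
Lemma computesComp g hs v y :
  computes (Comp g hs) v y =
  exists2 ws, computes_all v hs ws & computes g ws y.
Proof. by []. Qed.

Definition recursive (F : seq nat -> nat) :=
  exists f, forall v, computes f v (F v).

Lemma recursive_ext F F' : F =1 F' -> recursive F -> recursive F'.
Proof. by move=> eqF [f fP]; exists f => v; rewrite -eqF. Qed.

Lemma recursive_nth i : recursive (fun v => nth 0 v i).
Proof. by exists (Proj i). Qed.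

Lemma recursive_comp G Fs :
    recursive G -> (forall i, i < size Fs -> recursive (nth (fun=> 0) Fs i)) ->
  recursive (fun v => G [seq F v | F <- Fs]).
Proof.
move=> [g gP] FsP.
have [hs hsP]: exists hs, forall v, computes_all v hs [seq F v | F <- Fs].
  elim: Fs FsP => [|F Fs IH] FsP; first by exists [::].
  have [h hP] := FsP 0 isT; have [|hs hsP] := IH; first by move=> i; apply: (FsP i.+1).
  by exists (h :: hs) => v.
by exists (Comp g hs) => v; rewrite computesComp; eexists; [apply: hsP | apply: gP].
Qed.

Lemma recursive_prec G H : recursive G -> recursive H ->
  recursive (fun v => nat_rect (fun=> nat) (G (behead v))
                        (fun n z => H [:: n, z & behead v]) (head 0 v)).
Proof.
move=> [g gP] [h hP]; exists (PRec g h) => v /=; elim: (head 0 v) => [|n IH] /=.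
  exact: gP.
by eexists; [apply: IH | apply: hP].
Qed.

Definition recursive1 (g : nat -> nat) := recursive (fun v => g (nth 0 v 0)).
Definition recursive2 (g : nat -> nat -> nat) :=
  recursive (fun v => g (nth 0 v 0) (nth 0 v 1)).
Definition recursive3 (g : nat -> nat -> nat -> nat) :=
  recursive (fun v => g (nth 0 v 0) (nth 0 v 1) (nth 0 v 2)).

Lemma recursive1_comp g F : recursive1 g -> recursive F -> recursive (fun v => g (F v)).
Proof. by move=> rg rF; apply: (@recursive_comp (fun v => g (nth 0 v 0)) [:: F]) => // -[]. Qed.

Lemma recursive2_comp g F1 F2 : recursive2 g -> recursive F1 -> recursive F2 ->
  recursive (fun v => g (F1 v) (F2 v)).
Proof.
by move=> rg r1 r2; apply: (@recursive_comp (fun v => g (nth 0 v 0) (nth 0 v 1)) [:: F1; F2]) => // -[|[]].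
Qed.

Lemma recursive3_comp g F1 F2 F3 : recursive3 g ->
    recursive F1 -> recursive F2 -> recursive F3 ->
  recursive (fun v => g (F1 v) (F2 v) (F3 v)).
Proof.
by move=> rg r1 r2 r3; apply: (@recursive_comp (fun v => g (nth 0 v 0) (nth 0 v 1) (nth 0 v 2))
  [:: F1; F2; F3]) => // -[|[|[]]].
Qed.

Lemma recursive_succ F : recursive F -> recursive (fun v => (F v).+1).
Proof. by apply: recursive1_comp; exists Succ. Qed.

Lemma recursive_const n : recursive (fun=> n).
Proof. by elim: n => [|n]; [exists Zero | apply: recursive_succ]. Qed.

Lemma recursive2_iter (g : nat -> nat) (h : nat -> nat -> nat -> nat) :
    recursive1 g -> recursive3 h ->
  recursive2 (fun n c => nat_rect (fun=> nat) (g c) (fun k z => h k z c) n).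
Proof.
move=> rg rh; have := recursive_prec rg rh; rewrite /recursive2.
by apply: recursive_ext => v; rewrite /= nth_behead nth0.
Qed.

Lemma recursive3_iter (g : nat -> nat -> nat) (h : nat -> nat -> nat -> nat -> nat) :
    recursive2 g -> recursive (fun v => h (nth 0 v 0) (nth 0 v 1) (nth 0 v 2) (nth 0 v 3)) ->
  recursive3 (fun n c d => nat_rect (fun=> nat) (g c d) (fun k z => h k z c d) n).
Proof.
move=> rg rh; have := recursive_prec rg rh; rewrite /recursive3.
by apply: recursive_ext => v; rewrite /= !nth_behead nth0.
Qed.

Lemma recursive2_swap g : recursive2 g -> recursive2 (fun a b => g b a).
Proof. by move=> rg; apply: (recursive2_comp rg (recursive_nth 1) (recursive_nth 0)). Qed.

Lemma recursive2_addn : recursive2 addn.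
Proof.
apply: recursive_ext (recursive2_iter (g := id) (h := fun _ z _ => z.+1) _ _) => [v||].
- by elim: (nth 0 v 0) => //= n ->.
- exact: recursive_nth.
- exact/recursive_succ/recursive_nth.
Qed.

Lemma recursive1_pred : recursive1 predn.
Proof.
apply: recursive_ext
  (recursive2_comp (recursive2_iter (g := fun=> 0) (h := fun k _ _ => k) _ _)
     (recursive_nth 0) (recursive_nth 0)) => [v||].
- by case: (nth 0 v 0).
- exact: recursive_const.
- exact: recursive_nth.
Qed.

Lemma recursive2_subn : recursive2 subn.
Proof.
apply: (@recursive2_swap (fun b a => a - b)).
apply: recursive_ext (recursive2_iter (g := id) (h := fun _ z _ => z.-1) _ _) => [v||].
- by elim: (nth 0 v 0) => [|n IH] /=; rewrite ?subn0 // subnS -IH.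
- exact: recursive_nth.
- exact/(recursive1_comp recursive1_pred)/recursive_nth.
Qed.

Lemma recursive2_muln : recursive2 muln.
Proof.
apply: recursive_ext (recursive2_iter (g := fun=> 0) (h := fun _ z c => c + z) _ _) => [v||].
- by elim: (nth 0 v 0) => //= n ->; rewrite mulSn.
- exact: recursive_const.
- by apply: (recursive2_comp recursive2_addn); apply: recursive_nth.
Qed.

Lemma recursive1_exp2 : recursive1 (expn 2).
Proof.
apply: recursive_ext
  (recursive2_comp (recursive2_iter (g := fun=> 1) (h := fun _ z _ => z + z) _ _)
     (recursive_nth 0) (recursive_nth 0)) => [v||].
- by elim: (nth 0 v 0) => //= n ->; rewrite expnS mul2n addnn.
- exact: recursive_const.
- by apply: (recursive2_comp recursive2_addn); apply: recursive_nth.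
Qed.

Lemma recursive3_if : recursive3 (fun b x y => if b != 0 then x else y).
Proof.
apply: recursive_ext (recursive3_iter (g := fun c d => d) (h := fun _ _ c d => c) _ _) => [v||].
- by case: (nth 0 v 0).
- exact: recursive_nth.
- exact: recursive_nth.
Qed.

Lemma recursive2_eqn : recursive2 (fun x y => x == y : nat).
Proof.
have r2 := recursive2_comp.
apply: recursive_ext
  (recursive3_comp recursive3_if
     (r2 _ _ _ recursive2_addn
        (r2 _ _ _ recursive2_subn (recursive_nth 0) (recursive_nth 1))
        (r2 _ _ _ recursive2_subn (recursive_nth 1) (recursive_nth 0)))
     (recursive_const 0) (recursive_const 1)) => v.
by rewrite addn_eq0 !subn_eq0 -eqn_leq; case: eqP.
Qed.

(** * Lists of natural numbers coded as natural numbers *)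

(** One step of [CodeSeq.code]. The empty list has code 0, and every positive number is a cons cell
    in exactly one way. *)
Definition cons_code (a s : nat) : nat := 2 ^ a * s.*2.+1.
Definition head_code (s : nat) : nat := head 0 (CodeSeq.decode s).
Definition behead_code (s : nat) : nat := CodeSeq.code (behead (CodeSeq.decode s)).

Lemma decode_cons a s : CodeSeq.decode (cons_code a s) = a :: CodeSeq.decode s.
Proof. by rewrite -[LHS]CodeSeq.codeK -{1}[s]CodeSeq.decodeK -[RHS]CodeSeq.codeK CodeSeq.codeK. Qed.

Lemma head_cons a s : head_code (cons_code a s) = a.
Proof. by rewrite /head_code decode_cons. Qed.

Lemma behead_cons a s : behead_code (cons_code a s) = s.
Proof. by rewrite /behead_code decode_cons /= CodeSeq.decodeK. Qed.

Lemma cons_head_behead s : s != 0 -> cons_code (head_code s) (behead_code s) = s.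
Proof.
move=> s0; rewrite -[RHS]CodeSeq.decodeK /head_code /behead_code.
case: (CodeSeq.decode s) (CodeSeq.decodeK s) => [/= e|a l _ //].
by rewrite -e in s0.
Qed.

Lemma behead_code_lt s : s != 0 -> behead_code s < s.
Proof.
move=> s0; rewrite -[X in _ < X](cons_head_behead s0) /cons_code.
by rewrite (@leq_trans (behead_code s).*2.+1) ?ltnS -?addnn ?leq_addr // leq_pmull ?expn_gt0.
Qed.

(** Makes the code itself enough fuel for a loop over the list. *)
Lemma size_decode s : size (CodeSeq.decode s) <= s.
Proof.
elim/ltn_ind: s => s IH; have [->//|s0] := eqVneq s 0.
rewrite -{1}(cons_head_behead s0) decode_cons /=.
by apply: leq_trans (behead_code_lt s0); rewrite ltnS IH ?behead_code_lt.
Qed.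

Lemma recursive2_cons : recursive2 cons_code.
Proof.
apply: (recursive2_comp recursive2_muln).
  exact: (recursive1_comp recursive1_exp2 (recursive_nth 0)).
apply/recursive_succ; apply: recursive_ext
  (recursive2_comp recursive2_addn (recursive_nth 1) (recursive_nth 1)) => v.
by rewrite addnn.
Qed.

Lemma recursive2_sum g : recursive2 g ->
  recursive2 (fun n c => \sum_(i < n) g i c).
Proof.
move=> rg; apply: recursive_ext
    (recursive2_iter (g := fun=> 0) (h := fun k z c => z + g k c) _ _) => [v||].
- by elim: (nth 0 v 0) => [|n IH] /=; rewrite ?big_ord0 // big_ord_recr IH.
- exact: recursive_const.
- apply: (recursive2_comp recursive2_addn (recursive_nth 1)).
  exact: (recursive2_comp rg (recursive_nth 0) (recursive_nth 2)).
Qed.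

Lemma recursive3_sum g : recursive3 g ->
  recursive3 (fun n c d => \sum_(i < n) g i c d).
Proof.
move=> rg; apply: recursive_ext
    (recursive3_iter (g := fun _ _ => 0) (h := fun k z c d => z + g k c d) _ _) => [v||].
- by elim: (nth 0 v 0) => [|n IH] /=; rewrite ?big_ord0 // big_ord_recr IH.
- exact: recursive_const.
- apply: (recursive2_comp recursive2_addn (recursive_nth 1)).
  exact: (recursive3_comp rg (recursive_nth 0) (recursive_nth 2) (recursive_nth 3)).
Qed.

Lemma head_code_lt s : s != 0 -> head_code s < s.
Proof.
move=> s0; rewrite -[X in _ < X](cons_head_behead s0) /cons_code.
by apply: (@leq_trans (2 ^ head_code s)); [apply: ltn_expl | apply: leq_pmulr].
Qed.

Lemma cons_codeE a b s :
  (cons_code a b == s) = [&& s != 0, a == head_code s & b == behead_code s].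
Proof.
apply/eqP/and3P => [<-|[s0 /eqP-> /eqP->]]; last exact: cons_head_behead.
by rewrite head_cons behead_cons !eqxx muln_eq0 expn_eq0.
Qed.

Lemma sum_pick n (F : nat -> nat) i : i < n ->
  \sum_(j < n) F j * (j == i :> nat) = F i.
Proof.
move=> ltin; rewrite (bigD1 (Ordinal ltin)) //= eqxx muln1 big1 ?addn0 // => j.
by rewrite -val_eqE /= => /negPf->; rewrite muln0.
Qed.

(** Bounded search written as a sum: head and tail of a nonzero code s lie below s, so exactly one
    pair a, b < s contributes; s = 0 gives the empty sum, which agrees with the default. *)
Lemma recursive1_head : recursive1 head_code.
Proof.
have r2 := recursive2_comp.
have rin : recursive3 (fun b a s => (cons_code a b == s) : nat).
  exact: (r2 _ _ _ recursive2_eqn (r2 _ _ _ recursive2_cons (recursive_nth 1)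
           (recursive_nth 0)) (recursive_nth 2)).
have rout : recursive2 (fun a s => a * \sum_(b < s) (cons_code a b == s)).
  apply: (r2 _ _ _ recursive2_muln (recursive_nth 0)).
  exact: (recursive3_comp (recursive3_sum rin)
            (recursive_nth 1) (recursive_nth 0) (recursive_nth 1)).
apply: recursive_ext (r2 _ _ _ (recursive2_sum rout) (recursive_nth 0)
                        (recursive_nth 0)) => v.
set s := nth 0 v 0; have [->|s0] := eqVneq s 0; first by rewrite big_ord0.
rewrite -(sum_pick id (head_code_lt s0)); apply: eq_bigr => a _; congr (_ * _).
have [e|ne] := eqVneq; last first.
  by rewrite big1 // => b _; rewrite cons_codeE (negPf ne) andbF.
rewrite -[RHS](sum_pick (fun=> 1) (behead_code_lt s0)); apply: eq_bigr => b _.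
by rewrite cons_codeE s0 e eqxx mul1n.
Qed.

Lemma recursive1_behead : recursive1 behead_code.
Proof.
have r2 := recursive2_comp.
have rin : recursive3 (fun a b s => (cons_code a b == s) : nat).
  exact: (r2 _ _ _ recursive2_eqn (r2 _ _ _ recursive2_cons (recursive_nth 0)
           (recursive_nth 1)) (recursive_nth 2)).
have rout : recursive2 (fun b s => b * \sum_(a < s) (cons_code a b == s)).
  apply: (r2 _ _ _ recursive2_muln (recursive_nth 0)).
  exact: (recursive3_comp (recursive3_sum rin)
            (recursive_nth 1) (recursive_nth 0) (recursive_nth 1)).
apply: recursive_ext (r2 _ _ _ (recursive2_sum rout) (recursive_nth 0)
                        (recursive_nth 0)) => v.
set s := nth 0 v 0; have [->|s0] := eqVneq s 0; first by rewrite big_ord0.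
rewrite -(sum_pick id (behead_code_lt s0)); apply: eq_bigr => b _; congr (_ * _).
have [e|ne] := eqVneq; last first.
  by rewrite big1 // => a _; rewrite cons_codeE (negPf ne) !andbF.
rewrite -[RHS](sum_pick (fun=> 1) (head_code_lt s0)); apply: eq_bigr => a _.
by rewrite cons_codeE s0 e eqxx andbT mul1n.
Qed.

(** The state of the loop is the coded list of the accumulator followed by the entries still to be
    read. A step merges the first two entries and is stationary once only the accumulator is left,
    so surplus iterations do no harm. *)
Lemma recursive3_foldl g : recursive3 g ->
  recursive3 (fun c a s => foldl (g c) a (CodeSeq.decode s)).
Proof.
move=> rg; pose step x c := if behead_code x != 0 then
  cons_code (g c (head_code x) (head_code (behead_code x)))
            (behead_code (behead_code x)) else x.
have r1 := recursive1_comp; have r2 := recursive2_comp.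
have rh : recursive1 head_code := recursive1_head.
have rb : recursive1 behead_code := recursive1_behead.
have rstep : recursive (fun v => step (nth 0 v 1) (nth 0 v 2)).
  have rb1 := r1 _ _ rb (recursive_nth 1).
  apply: (recursive3_comp recursive3_if rb1 _ (recursive_nth 1)).
  apply: (r2 _ _ _ recursive2_cons _ (r1 _ _ rb rb1)).
  exact: (recursive3_comp rg (recursive_nth 2) (r1 _ _ rh (recursive_nth 1)) (r1 _ _ rh rb1)).
have rit := recursive3_iter (g := fun c d => d) (h := fun _ z c _ => step z c)
  (recursive_nth 1) rstep.
apply: recursive_ext (r1 _ _ rh (recursive3_comp rit (recursive_nth 2) (recursive_nth 0)
  (r2 _ _ _ recursive2_cons (recursive_nth 1) (recursive_nth 2)))) => v.
move: (nth 0 v 0) (nth 0 v 1) (nth 0 v 2) => c a s.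
have {rg rit rstep} -> n : nat_rect (fun=> nat) (cons_code a s) (fun _ z => step z c) n
    = iter n (step^~ c) (cons_code a s) by elim: n => //= n ->.
have fold_iter n : size (CodeSeq.decode s) <= n ->
    head_code (iter n (step^~ c) (cons_code a s)) = foldl (g c) a (CodeSeq.decode s).
  elim: n a s => [|n IH] a s.
    rewrite leqn0 size_eq0 => /eqP e; rewrite -[s]CodeSeq.decodeK e /=.
    exact: head_cons.
  rewrite iterSr {2}/step behead_cons head_cons.
  have [->|s0] := eqVneq s 0; last first.
    rewrite -{1 5}(cons_head_behead s0) decode_cons /= ltnS => /IH.
    by [].
  move=> _; rewrite /=; elim: n {IH} => [|n IH]; first exact: head_cons.
  by rewrite iterSr {2}/step behead_cons.
exact: (fold_iter s (size_decode s)).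
Qed.

Definition rev_code s := foldl (fun z x => cons_code x z) 0 (CodeSeq.decode s).

Lemma decode_rev s : CodeSeq.decode (rev_code s) = rev (CodeSeq.decode s).
Proof.
rewrite /rev_code /rev; set t := 0; rewrite -[[::]]/(CodeSeq.decode t).
elim: (CodeSeq.decode s) t => //= a l IH t.
by rewrite -decode_cons IH.
Qed.

Lemma recursive3_foldr g : recursive3 g ->
  recursive3 (fun c a s => foldr (g c) a (CodeSeq.decode s)).
Proof.
move=> rg.
have rrev : recursive1 rev_code.
  have rc : recursive3 (fun c z x => cons_code x z).
    exact: (recursive2_comp recursive2_cons (recursive_nth 2) (recursive_nth 1)).
  exact: (recursive3_comp (recursive3_foldl rc) (recursive_const 0)
            (recursive_const 0) (recursive_nth 0)).
have rg' : recursive3 (fun c z x => g c x z).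
  exact: (recursive3_comp rg (recursive_nth 0) (recursive_nth 2) (recursive_nth 1)).
apply: recursive_ext (recursive3_comp (recursive3_foldl rg') (recursive_nth 0)
  (recursive_nth 1) (recursive1_comp rrev (recursive_nth 2))) => v.
by rewrite decode_rev foldl_rev.
Qed.

(** * Computable functions between encoded types *)

(** A computable map acts on all numbers, also on those that are not codes; the last field says that
    normalising a number to a code is recursive, which makes the identity and [decode]
    computable. *)
Class encoding (A : Type) := Encoding {
  encode : A -> nat;
  decode : nat -> A;
  encodeK : cancel encode decode;
  recursive_encode_decode : recursive1 (fun n => encode (decode n)) }.

#[export] Instance nat_encoding : encoding nat :=
  @Encoding nat id id (fun=> erefl) (recursive_nth 0).

Lemma recursive1_bool : recursive1 (fun n => (n != 0) : nat).
Proof.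
have r := recursive3_comp recursive3_if (recursive_nth 0)
  (recursive_const 1) (recursive_const 0).
by apply: recursive_ext r => v; case: (nth 0 v 0).
Qed.

Lemma nat_of_boolK : cancel nat_of_bool (fun n => n != 0).
Proof. by case. Qed.

#[export] Instance bool_encoding : encoding bool :=
  Encoding nat_of_boolK recursive1_bool.

Section Prod.
Context {A B : Type} {eA : encoding A} {eB : encoding B}.

Definition encode_pair (x : A * B) := cons_code (encode x.1) (encode x.2).
Definition decode_pair n : A * B := (decode (head_code n), decode (behead_code n)).

Lemma encode_pairK : cancel encode_pair decode_pair.
Proof. by case=> a b; rewrite /decode_pair head_cons behead_cons !encodeK. Qed.

Lemma recursive_encode_decode_pair :
  recursive1 (fun n => encode_pair (decode_pair n)).
Proof.
apply: (recursive2_comp recursive2_cons).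
  exact: (recursive1_comp (recursive_encode_decode (A := A))
            (recursive1_comp recursive1_head (recursive_nth 0))).
exact: (recursive1_comp (recursive_encode_decode (A := B))
          (recursive1_comp recursive1_behead (recursive_nth 0))).
Qed.

#[export] Instance prod_encoding : encoding (A * B) :=
  Encoding encode_pairK recursive_encode_decode_pair.
End Prod.

Section Seq.
Context {A : Type} {eA : encoding A}.

Definition encode_seq (s : seq A) := CodeSeq.code [seq encode x | x <- s].
Definition decode_seq n : seq A := [seq decode x | x <- CodeSeq.decode n].

Lemma encode_seqK : cancel encode_seq decode_seq.
Proof. by move=> s; rewrite /decode_seq CodeSeq.codeK (mapK encodeK). Qed.

Lemma recursive_encode_decode_seq : recursive1 (fun n => encode_seq (decode_seq n)).
Proof.
have rg : recursive3 (fun _ x z => cons_code (encode (decode x : A)) z).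
  apply: (recursive2_comp recursive2_cons _ (recursive_nth 2)).
  exact: (recursive1_comp recursive_encode_decode (recursive_nth 1)).
apply: recursive_ext (recursive3_comp (recursive3_foldr rg) (recursive_const 0)
  (recursive_const 0) (recursive_nth 0)) => v.
by rewrite /encode_seq -map_comp /CodeSeq.code foldr_map.
Qed.

#[export] Instance seq_encoding : encoding (seq A) :=
  Encoding encode_seqK recursive_encode_decode_seq.
End Seq.

Definition computable {A B} {eA : encoding A} {eB : encoding B} (f : A -> B) :=
  recursive1 (fun n => encode (f (decode n))).

Lemma computableE {A B} {eA : encoding A} {eB : encoding B} (f : A -> B) :
  computable f -> recursive1 (fun n => encode (f (decode n))).
Proof. by []. Qed.

Section Computable.
Context {A B C : Type} {eA : encoding A} {eB : encoding B} {eC : encoding C}.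

Lemma computable_ext (f g : A -> B) : f =1 g -> computable f -> computable g.
Proof. by move=> eqfg; apply: recursive_ext => v; rewrite eqfg. Qed.

Lemma computable_id : computable (fun x : A => x).
Proof. exact: recursive_encode_decode. Qed.

Lemma computable_const (b : B) : computable (fun _ : A => b).
Proof. exact: recursive_const. Qed.

Lemma computable_comp (g : B -> C) (f : A -> B) :
  computable g -> computable f -> computable (fun x => g (f x)).
Proof.
move=> cg cf; apply: recursive_ext (recursive1_comp (computableE cg) cf) => v.
by rewrite /= (@encodeK _ eB).
Qed.

Lemma computable_pair (f : A -> B) (g : A -> C) :
  computable f -> computable g -> computable (fun x => (f x, g x)).
Proof. exact: recursive2_comp recursive2_cons. Qed.

Lemma computable_fst (f : A -> B * C) :
  computable f -> computable (fun x => (f x).1).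
Proof.
move=> cf; apply: recursive_ext (recursive1_comp recursive1_head cf) => v.
rewrite /=; exact: head_cons.
Qed.

Lemma computable_snd (f : A -> B * C) :
  computable f -> computable (fun x => (f x).2).
Proof.
move=> cf; apply: recursive_ext (recursive1_comp recursive1_behead cf) => v.
rewrite /=; exact: behead_cons.
Qed.

Lemma computable_encode (f : A -> B) :
  computable f -> computable (fun x => encode (f x)).
Proof. by []. Qed.

Lemma computable_if (b : A -> bool) (f g : A -> B) :
    computable b -> computable f -> computable g ->
  computable (fun x => if b x then f x else g x).
Proof.
move=> cb cf cg; apply: recursive_ext (recursive3_comp recursive3_if cb cf cg) => v.
by rewrite /=; case: (b _).
Qed.

Lemma computable_cons (f : A -> B) (g : A -> seq B) :
  computable f -> computable g -> computable (fun x => f x :: g x).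
Proof. exact: recursive2_comp recursive2_cons. Qed.

Lemma computable_behead (f : A -> seq B) :
  computable f -> computable (fun x => behead (f x)).
Proof.
move=> cf; apply: recursive_ext (recursive1_comp recursive1_behead cf) => v /=.
rewrite /behead_code CodeSeq.codeK /encode_seq; by case: (f _).
Qed.

Lemma computable_head (d : B) (f : A -> seq B) :
  computable f -> computable (fun x => head d (f x)).
Proof.
move=> cf; have r1 := recursive1_comp.
apply: recursive_ext
  (recursive3_comp recursive3_if cf (r1 _ _ recursive1_head cf)
     (recursive_const (encode d))) => v.
rewrite /= /head_code /encode_seq; set s := f _; rewrite CodeSeq.codeK.
by case: s => //= x s; rewrite muln_eq0 expn_eq0.
Qed.

Lemma computable_foldr (g : A -> B -> C -> C) (i : A -> C) (s : A -> seq B) :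
    computable (fun x : A * B * C => g x.1.1 x.1.2 x.2) ->
    computable i -> computable s ->
  computable (fun x => foldr (g x) (i x) (s x)).
Proof.
move=> cg ci cs; have r2 := recursive2_comp.
have rg : recursive3 (fun a b c => encode (g (decode a) (decode b) (decode c))).
  apply: recursive_ext (recursive1_comp (computableE cg) (r2 _ _ _ recursive2_cons
    (r2 _ _ _ recursive2_cons (recursive_nth 0) (recursive_nth 1)) (recursive_nth 2))) => v.
  by rewrite /= /decode_pair /= head_cons behead_cons /decode_pair head_cons behead_cons.
apply: recursive_ext (recursive3_comp (recursive3_foldr rg) (recursive_nth 0) ci cs) => v.
rewrite CodeSeq.codeK foldr_map; elim: (s _) => //= b l ->.
by rewrite (@encodeK _ eB) (@encodeK _ eC).
Qed.

Lemma computable_nat_rect (i : A -> B) (g : A -> nat -> B -> B) (n : A -> nat) :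
    computable (fun x : A * nat * B => g x.1.1 x.1.2 x.2) ->
    computable i -> computable n ->
  computable (fun x => nat_rect (fun=> B) (i x) (g x) (n x)).
Proof.
move=> cg ci cn; have r2 := recursive2_comp.
have rg : recursive3 (fun k b a => encode (g (decode a) k (decode b))).
  apply: recursive_ext (recursive1_comp (computableE cg) (r2 _ _ _ recursive2_cons
    (r2 _ _ _ recursive2_cons (recursive_nth 2) (recursive_nth 0)) (recursive_nth 1))) => v.
  by rewrite /= /decode_pair /= head_cons behead_cons /decode_pair head_cons behead_cons.
apply: recursive_ext (r2 _ _ _ (recursive2_iter (computableE ci) rg) cn (recursive_nth 0)) => v.
by rewrite /=; elim: (n _) => //= k ->; rewrite (@encodeK _ eB).
Qed.
End Computable.

Lemma computable_fst_id {A B : Type} {eA : encoding A} {eB : encoding B} :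
  computable (@fst A B).
Proof. exact: (@computable_fst (A * B) A B _ _ _ id computable_id). Qed.

Lemma computable_snd_id {A B : Type} {eA : encoding A} {eB : encoding B} :
  computable (@snd A B).
Proof. exact: (@computable_snd (A * B) A B _ _ _ id computable_id). Qed.

Lemma computable_decode (A B : Type) {eA : encoding A} {eB : encoding B} (f : A -> nat) :
  computable f -> computable (fun x => decode (f x) : B).
Proof.
by move=> cf; apply: (@computable_comp _ _ _ _ _ _ decode f recursive_encode_decode cf).
Qed.

Lemma computable_eq (A : Type) (B : eqType) {eA : encoding A} {eB : encoding B}
    (f g : A -> B) :
  computable f -> computable g -> computable (fun x => f x == g x).
Proof.
move=> cf cg; apply: recursive_ext (recursive2_comp recursive2_eqn cf cg) => v.
by rewrite (can_eq (@encodeK _ eB)).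
Qed.

Ltac computability_core := repeat first
  [ exact: computable_id | exact: computable_const | assumption
  | exact: computable_fst_id | exact: computable_snd_id
  | apply: computable_fst | apply: computable_snd | apply: computable_pair
  | apply: computable_cons | apply: computable_behead | apply: computable_head
  | apply: computable_eq | apply: computable_if | apply: computable_foldr
  | apply: computable_nat_rect ].

Lemma computable_subn {A : Type} {eA : encoding A} (f g : A -> nat) :
  computable f -> computable g -> computable (fun x => f x - g x).
Proof. exact: recursive2_comp recursive2_subn. Qed.

Lemma computable_addn {A : Type} {eA : encoding A} (f g : A -> nat) :
  computable f -> computable g -> computable (fun x => f x + g x).
Proof. exact: recursive2_comp recursive2_addn. Qed.

Lemma computable_succn {A : Type} {eA : encoding A} (f : A -> nat) :
  computable f -> computable (fun x => (f x).+1).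
Proof. exact: recursive_succ. Qed.

Lemma computable_predn {A : Type} {eA : encoding A} (f : A -> nat) :
  computable f -> computable (fun x => (f x).-1).
Proof. exact: recursive1_comp recursive1_pred. Qed.

Lemma computable_leq {A : Type} {eA : encoding A} (f g : A -> nat) :
  computable f -> computable g -> computable (fun x => f x <= g x).
Proof.
move=> cf cg; apply: (@computable_ext _ _ _ _ (fun x => f x - g x == 0)) => //.
exact: (computable_eq (computable_subn cf cg) (computable_const 0)).
Qed.

Lemma computable_negb {A : Type} {eA : encoding A} (b : A -> bool) :
  computable b -> computable (fun x => ~~ b x).
Proof. by move=> cb; apply: computable_if => //; apply: computable_const. Qed.

Lemma computable_andb {A : Type} {eA : encoding A} (b c : A -> bool) :
  computable b -> computable c -> computable (fun x => b x && c x).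
Proof. by move=> cb cc; apply: computable_if => //; apply: computable_const. Qed.

Lemma computable_orb {A : Type} {eA : encoding A} (b c : A -> bool) :
  computable b -> computable c -> computable (fun x => b x || c x).
Proof. by move=> cb cc; apply: computable_if => //; apply: computable_const. Qed.

Lemma computable_cat {A B : Type} {eA : encoding A} {eB : encoding B} (f g : A -> seq B) :
  computable f -> computable g -> computable (fun x => f x ++ g x).
Proof.
move=> cf cg; apply: (@computable_ext _ _ _ _ (fun x => foldr cons (g x) (f x))).
  by move=> x; elim: (f x) => //= a s ->.
by computability_core.
Qed.

Lemma computable_map {A B C : Type} {eA : encoding A} {eB : encoding B} {eC : encoding C}
    (g : A -> B -> C) (s : A -> seq B) :
    computable (fun x : A * B => g x.1 x.2) -> computable s ->
  computable (fun x => map (g x) (s x)).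
Proof.
move=> cg cs.
apply: (@computable_ext _ _ _ _ (fun x => foldr (fun b r => g x b :: r) [::] (s x))).
  by move=> x; elim: (s x) => //= a l ->.
computability_core.
apply: (@computable_comp _ _ _ _ _ _ (fun x => g x.1 x.2)
  (fun x : A * B * seq C => (x.1.1, x.1.2))) => //.
by computability_core.
Qed.

Lemma computable_filter {A B : Type} {eA : encoding A} {eB : encoding B}
    (g : A -> B -> bool) (s : A -> seq B) :
    computable (fun x : A * B => g x.1 x.2) -> computable s ->
  computable (fun x => filter (g x) (s x)).
Proof.
move=> cg cs.
apply: (@computable_ext _ _ _ _
  (fun x => foldr (fun b r => if g x b then b :: r else r) [::] (s x))) => //.
computability_core.
apply: (@computable_comp _ _ _ _ _ _ (fun x => g x.1 x.2)
  (fun x : A * B * seq B => (x.1.1, x.1.2))) => //.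
by computability_core.
Qed.

Lemma computable_flatten {A B : Type} {eA : encoding A} {eB : encoding B}
    (s : A -> seq (seq B)) :
  computable s -> computable (fun x => flatten (s x)).
Proof.
move=> cs; rewrite /flatten; computability_core.
by apply: (computable_cat); computability_core.
Qed.

Lemma computable_has {A B : Type} {eA : encoding A} {eB : encoding B}
    (g : A -> B -> bool) (s : A -> seq B) :
    computable (fun x : A * B => g x.1 x.2) -> computable s ->
  computable (fun x => has (g x) (s x)).
Proof.
move=> cg cs.
apply: (@computable_ext _ _ _ _
  (fun x => foldr (fun b r => if g x b then true else r) false (s x))) => [x|].
  by elim: (s x) => //= b l ->.
computability_core.
apply: (@computable_comp _ _ _ _ _ _ (fun x => g x.1 x.2)
  (fun x : A * B * bool => (x.1.1, x.1.2))) => //.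
by computability_core.
Qed.

Lemma computable_all {A B : Type} {eA : encoding A} {eB : encoding B}
    (g : A -> B -> bool) (s : A -> seq B) :
    computable (fun x : A * B => g x.1 x.2) -> computable s ->
  computable (fun x => all (g x) (s x)).
Proof.
move=> cg cs.
apply: (@computable_ext _ _ _ _ (fun x => ~~ has (fun b => ~~ g x b) (s x))) => [x|].
  by rewrite -all_predC; apply: eq_all => b /=; rewrite negbK.
by apply/computable_negb/computable_has => //; apply: computable_negb.
Qed.

Lemma computable_nth {A B : Type} {eA : encoding A} {eB : encoding B}
    (d : B) (s : A -> seq B) (n : A -> nat) :
  computable s -> computable n -> computable (fun x => nth d (s x) (n x)).
Proof.
move=> cs cn; apply: (@computable_ext _ _ _ _
    (fun x => head d (nat_rect (fun=> seq B) (s x) (fun _ z => behead z) (n x)))).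
  move=> x; have -> k : nat_rect (fun=> seq B) (s x) (fun _ z => behead z) k = drop k (s x).
    by elim: k => [|k /= ->]; rewrite ?drop0 // -drop1 drop_drop add1n.
  by rewrite -nth0 nth_drop addn0.
by computability_core.
Qed.

Lemma computable_size {A B : Type} {eA : encoding A} {eB : encoding B} (s : A -> seq B) :
  computable s -> computable (fun x => size (s x)).
Proof.
move=> cs; apply: (@computable_ext _ _ _ _ (fun x => foldr (fun _ k => k.+1) 0 (s x))).
  by move=> x; elim: (s x) => //= b l ->.
computability_core; apply: computable_succn; computability_core.
Qed.

Lemma computable_nseq {A B : Type} {eA : encoding A} {eB : encoding B}
    (n : A -> nat) (f : A -> B) :
  computable n -> computable f -> computable (fun x => nseq (n x) (f x)).
Proof.
move=> cn cf; apply: (@computable_ext _ _ _ _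
    (fun x => nat_rect (fun=> seq B) [::] (fun _ z => f x :: z) (n x))).
  by move=> x; elim: (n x) => //= k ->.
computability_core.
by apply: (computable_comp cf); computability_core.
Qed.

Lemma computable_iota {A : Type} {eA : encoding A} (m n : A -> nat) :
  computable m -> computable n -> computable (fun x => iota (m x) (n x)).
Proof.
move=> cm cn; apply: (@computable_ext _ _ _ _
    (fun x => nat_rect (fun=> seq nat) [::] (fun k z => z ++ [:: m x + k]) (n x))).
  by move=> x; elim: (n x) => // k IH; rewrite [LHS]/= IH -[in RHS]addn1 iotaD.
computability_core; apply: computable_cat; computability_core; apply: computable_addn; computability_core.
by apply: (computable_comp cm); computability_core.
Qed.

Lemma computable_odd {A : Type} {eA : encoding A}
    (n : A -> nat) : computable n -> computable (fun x => odd (n x)).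
Proof.
move=> cn; apply: (@computable_ext _ _ _ _
    (fun x => nat_rect (fun=> bool) false (fun _ z => ~~ z) (n x))).
  by move=> x; elim: (n x) => //= k ->.
by computability_core; apply: computable_negb; computability_core.
Qed.

Lemma computable_modn {A : Type} {eA : encoding A} (p : nat) (n : A -> nat) : 0 < p ->
  computable n -> computable (fun x => n x %% p).
Proof.
move=> p0 cn; apply: (@computable_ext _ _ _ _
    (fun x => nat_rect (fun=> nat) 0 (fun _ z => if z.+1 == p then 0 else z.+1) (n x))).
  move=> x; elim: (n x) => [|k /= ->]; first by rewrite mod0n.
  rewrite -[in RHS]addn1 -modnDml addn1; case: eqP => [->|ne]; first by rewrite modnn.
  by rewrite [RHS]modn_small // ltn_neqAle ltn_pmod // andbT; apply/eqP.
by computability_core; apply: computable_succn; computability_core.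
Qed.

Lemma computable_mem {A : Type} {B : eqType} {eA : encoding A} {eB : encoding B}
    (f : A -> B) (s : A -> seq B) :
  computable f -> computable s -> computable (fun x => f x \in s x).
Proof.
move=> cf cs; apply: (@computable_ext _ _ _ _ (fun x => has (pred1 (f x)) (s x))).
  by move=> x; rewrite has_pred1.
apply: computable_has => //=; apply: computable_eq; computability_core.
by apply: (computable_comp cf); computability_core.
Qed.

Lemma computable_count_mem {A : Type} {B : eqType} {eA : encoding A} {eB : encoding B}
    (f : A -> B) (s : A -> seq B) :
  computable f -> computable s -> computable (fun x => count_mem (f x) (s x)).
Proof.
move=> cf cs; apply: (@computable_ext _ _ _ _ (fun x => size (filter (pred1 (f x)) (s x)))).
  by move=> x; rewrite size_filter.
apply: computable_size; apply: computable_filter => //=.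
apply: computable_eq; computability_core.
by apply: (computable_comp cf); computability_core.
Qed.
Lemma computable_half {A : Type} {eA : encoding A} (n : A -> nat) :
  computable n -> computable (fun x => (n x)./2).
Proof.
move=> cn; apply: (@computable_ext _ _ _ _
    (fun x => nat_rect (fun=> nat) 0 (fun k z => odd k + z) (n x))).
  by move=> x; elim: (n x) => //= k ->; rewrite uphalf_half.
computability_core; apply: computable_addn; computability_core.
apply: (@computable_comp _ _ _ _ _ _ nat_of_bool (fun x : A * nat * nat => odd x.1.2)).
  exact: recursive1_bool.
by apply: computable_odd; computability_core.
Qed.

Ltac computability := repeat match goal with
  | |- computable (fun x => x) => exact: computable_id
  | |- computable fst => exact: computable_fst_id
  | |- computable snd => exact: computable_snd_id
  | |- computable _ => exact: computable_const
  | |- computable _ => assumption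
  | |- computable (fun x => (@?f x).1) => apply: computable_fst
  | |- computable (fun x => (@?f x).2) => apply: computable_snd
  | |- computable (fun x => (@?f x, @?g x)) => apply: computable_pair
  | |- computable (fun x => @?f x :: @?g x) => apply: computable_cons
  | |- computable (fun x => behead (@?f x)) => apply: computable_behead
  | |- computable (fun x => head ?d (@?f x)) => apply: computable_head
  | |- computable (fun x => nth ?d (@?f x) (@?g x)) => apply: computable_nth
  | |- computable (fun x => size (@?f x)) => apply: computable_size
  | |- computable (fun x => @?f x ++ @?g x) => apply: computable_cat
  | |- computable (fun x => flatten (@?f x)) => apply: computable_flatten
  | |- computable (fun x => nseq (@?f x) (@?g x)) => apply: computable_nseq
  | |- computable (fun x => iota (@?f x) (@?g x)) => apply: computable_iota
  | |- computable (fun x => map (@?f x) (@?g x)) => apply: computable_map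
  | |- computable (fun x => filter (@?f x) (@?g x)) => apply: computable_filter
  | |- computable (fun x => all (@?f x) (@?g x)) => apply: computable_all
  | |- computable (fun x => has (@?f x) (@?g x)) => apply: computable_has
  | |- computable (fun x => encode (@?f x)) => apply: computable_encode
  | |- computable (fun x => decode (@?f x)) => apply: computable_decode
  | |- computable (fun x => (@?f x).+1) => apply: computable_succn
  | |- computable (fun x => (@?f x).-1) => apply: computable_predn
  | |- computable (fun x => @?f x + @?g x) => apply: computable_addn
  | |- computable (fun x => @?f x - @?g x) => apply: computable_subn
  | |- computable (fun x => @?f x <= @?g x) => apply: computable_leq
  | |- computable (fun x => odd (@?f x)) => apply: computable_odd
  | |- computable (fun x => (@?f x)./2) => apply: computable_half
  | |- computable (fun x => @?f x %% ?p) => apply: computable_modn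
  | |- computable (fun x => ~~ @?f x) => apply: computable_negb
  | |- computable (fun x => @?f x && @?g x) => apply: computable_andb
  | |- computable (fun x => @?f x || @?g x) => apply: computable_orb
  | |- computable (fun x => @?f x == @?g x) => apply: computable_eq
  | |- computable (fun x => count (@?f x) (@?g x)) => apply: computable_count_mem
  | |- computable (fun x => in_mem (@?f x) (@?g x)) => apply: computable_mem
  | |- computable (fun x => foldr (@?h x) (@?f x) (@?g x)) => apply: computable_foldr
  | |- computable _ => apply: computable_if
  | |- computable _ => apply: computable_nat_rect
  end.

(** * Semi-decidable predicates *)

(** Recursive enumerability in projection form: with explicit certificates c, closure properties
    become computable manipulations of certificates, and no programmes have to be run in
    parallel. *)
Definition semidecidable {A} {eA : encoding A} (P : A -> Prop) :=
  exists2 F : A * nat -> bool, computable F & forall a, P a <-> exists c, F (a, c).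

Section Semidecidable.
Context {A B : Type} {eA : encoding A} {eB : encoding B}.

Lemma semidecidable_iff (P Q : A -> Prop) :
  (forall a, P a <-> Q a) -> semidecidable P -> semidecidable Q.
Proof. by move=> PQ [F cF FP]; exists F => // a; rewrite -PQ. Qed.

Lemma semidecidable_bool (F : A -> bool) : computable F -> semidecidable F.
Proof.
move=> cF; exists (fun x => F x.1); last by move=> a; split=> [|[]] //; exists 0.
by apply: (computable_comp cF); apply: computable_fst; apply: computable_id.
Qed.

Lemma semidecidable_comp (P : B -> Prop) (f : A -> B) :
  semidecidable P -> computable f -> semidecidable (fun a => P (f a)).
Proof.
move=> [F cF FP] cf; exists (fun x => F (f x.1, x.2)); last by move=> a; apply: FP.
apply: (computable_comp cF); apply: computable_pair.
  by apply: (computable_comp cf); apply: computable_fst; apply: computable_id.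
by apply: computable_snd; apply: computable_id.
Qed.

Lemma semidecidable_and (P Q : A -> Prop) :
  semidecidable P -> semidecidable Q -> semidecidable (fun a => P a /\ Q a).
Proof.
move=> [F cF FP] [G cG GQ].
exists (fun x => F (x.1, (decode x.2 : nat * nat).1) && G (x.1, (decode x.2 : nat * nat).2)).
  have c2 : computable (fun x : A * nat => decode x.2 : nat * nat).
    by apply: computable_decode; computability.
  by apply: computable_andb; [apply: (computable_comp cF) | apply: (computable_comp cG)];
    apply: computable_pair; computability.
move=> a; rewrite FP GQ; split=> [[[c Fc] [d Gd]]|[c /andP[Fc Gc]]].
  by exists (encode (c, d)); rewrite encodeK Fc.
by split; eexists; [apply: Fc | apply: Gc].
Qed.

Lemma semidecidable_or (P Q : A -> Prop) :
  semidecidable P -> semidecidable Q -> semidecidable (fun a => P a \/ Q a).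
Proof.
move=> [F cF FP] [G cG GQ]; exists (fun x => F x || G x).
  exact: computable_orb.
move=> a; rewrite FP GQ; split=> [[] [c Fc]|[c /orP[] Fc]]; last 2 first.
- by left; exists c.
- by right; exists c.
- by exists c; rewrite Fc.
- by exists c; rewrite Fc orbT.
Qed.

Lemma semidecidable_ex (P : A -> B -> Prop) :
  semidecidable (fun x : A * B => P x.1 x.2) -> semidecidable (fun a => exists b, P a b).
Proof.
move=> [F cF FP]; pose D := @decode (B * nat) (@prod_encoding B nat eB nat_encoding).
exists (fun x => F (x.1, (D x.2).1, (D x.2).2)).
  have c2 : computable (fun x : A * nat => D x.2).
    by apply: computable_decode; computability.
  apply: (computable_comp cF); computability.
move=> a; split=> [[b /(FP (a, b)) [c Fc]]|[c Fc]].
  by exists (encode (b, c)); rewrite /D encodeK.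
by exists (D c).1; apply/(FP (a, _)); exists (D c).2.
Qed.
End Semidecidable.

Lemma semidecidable_eq {A} {B : eqType} {eA : encoding A} {eB : encoding B}
    (f g : A -> B) :
  computable f -> computable g -> semidecidable (fun a => f a = g a).
Proof.
move=> cf cg; apply: semidecidable_iff (semidecidable_bool (computable_eq cf cg)) => a.
by split=> /eqP.
Qed.

(** The certificate is a finite list in which every entry of [s a] finds its own certificate. *)
Lemma semidecidable_all {A} {B : eqType} {eA : encoding A} {eB : encoding B}
    (P : A -> B -> Prop) (s : A -> seq B) :
    semidecidable (fun x : A * B => P x.1 x.2) -> computable s ->
  semidecidable (fun a => forall b, b \in s a -> P a b).
Proof.
move=> [F cF FP] cs; pose D := @decode (seq nat) (@seq_encoding nat nat_encoding).
exists (fun x => all (fun b => has (fun c => F (x.1, b, c)) (D x.2)) (s x.1)).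
  have c2 : computable (fun x : A * nat * B => D x.1.2).
    by apply: computable_decode; computability.
  apply: computable_all; last by apply: (computable_comp cs); computability.
  apply: computable_has => //.
  by apply: (computable_comp cF); computability.
move=> a; split=> [sP|[c /allP /= cP] b /cP /hasP[d _ Fd]]; last first.
  by apply/(FP (a, b)); exists d.
suff [cl clP] : exists cl, all (fun b => has (fun c => F (a, b, c)) cl) (s a).
  by exists (encode cl); rewrite /D encodeK.
elim: (s a) sP => [|b l IH] sP; first by exists [::].
have [|cl clP] := IH; first by move=> b' b'l; apply: sP; rewrite inE b'l orbT.
have [c Fc] := (FP (a, b)).1 (sP b (mem_head b l)).
exists (c :: cl); rewrite /= Fc /=; apply: sub_all clP => b' /= ->.
by rewrite orbT.
Qed.

(** Search through all codes of pairs (b, c), with c a certificate for b, and keep the b of the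
    first success. Being first is decidable, so single-valuedness costs nothing in effectiveness. *)
Lemma semidecidable_uniformization {A B} {eA : encoding A} {eB : encoding B}
    (P : A -> B -> Prop) :
    semidecidable (fun x : A * B => P x.1 x.2) ->
  exists Q : A -> B -> Prop,
  [/\ semidecidable (fun x : A * B => Q x.1 x.2),
      forall a b, Q a b -> P a b,
      forall a b b', Q a b -> Q a b' -> b = b'
    & forall a b, P a b -> exists b', Q a b'].
Proof.
move=> [F cF FP]; pose D := @decode (B * nat) (@prod_encoding B nat eB nat_encoding).
pose G (x : A * nat) := F (x.1, (D x.2).1, (D x.2).2).
have cG : computable G.
  have c2 : computable (fun x : A * nat => D x.2).
    by apply: computable_decode; computability.
  by apply: (computable_comp cF); computability.
pose least a n := G (a, n) && all (fun m => ~~ G (a, m)) (iota 0 n).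
exists (fun a b => exists2 n, least a n & (D n).1 = b); split.
(* B carries no decidable equality, so results are compared through their codes. *)
- exists (fun x => least x.1.1 x.2 && (encode (D x.2).1 == encode x.1.2)).
    have c2 : computable (fun x : A * B * nat => D x.2).
      by apply: computable_decode; computability.
    apply: computable_andb; last by apply: computable_eq; apply: computable_encode; computability.
    apply: computable_andb; first by apply: (computable_comp cG); computability.
    apply: computable_all; last by apply: computable_iota; computability.
    by apply: computable_negb; apply: (computable_comp cG); computability.
  move=> [a b] /=; split=> [[n ln <-]|[n /andP[ln /eqP e]]]; exists n => //.
    by rewrite ln eqxx.
  exact: can_inj encodeK _ _ e.
- by move=> a b [n /andP[Gn _] <-]; apply/(FP (a, _)); exists (D n).2.
- move=> a b b' [n /andP[Gn /allP nP] <-] [n' /andP[Gn' /allP nP'] <-].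
  case: (ltngtP n n') => [ltn|gtn|-> //].
    by have := nP' n; rewrite mem_iota add0n ltn Gn => /(_ isT).
  by have := nP n'; rewrite mem_iota add0n gtn Gn' => /(_ isT).
- move=> a b /(FP (a, b)) [c Fc].
  have exG : exists n, G (a, n) by exists (encode (b, c)); rewrite /G /D encodeK.
  exists (D (ex_minn exG)).1; exists (ex_minn exG) => //.
  case: ex_minnP => n Gn nmin; rewrite /least Gn; apply/allP => m.
  by rewrite mem_iota add0n; apply: contraL => /nmin; rewrite -leqNgt.
Qed.

Ltac semidecidability := repeat first
  [ apply: semidecidable_and | apply: semidecidable_or | apply: semidecidable_ex
  | apply: semidecidable_eq | apply: semidecidable_bool ]; computability.

(** * Inductive definitions *)

Section Derivable.
Context {X : eqType} {eX : encoding X}.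
Variable rule : X -> seq X -> Prop.

Let x0 : X := decode 0.

(** A proof read backwards: each entry follows from entries to its right, so a new conclusion is
    prepended. The indexed form is a bounded quantifier, as [semidecidable_all] wants it;
    [derivation_cons] is the recursive form for inductions. *)
Definition derivation (L : seq X) :=
  forall i, i \in iota 0 (size L) -> rule (nth x0 L i) (drop i.+1 L).

Definition derivable (x : X) := exists2 L, derivation L & x \in L.

Lemma derivation_cons x L : derivation (x :: L) <-> rule x L /\ derivation L.
Proof.
split=> [dL|[rx dL] [_|i]]; last 2 first.
- by rewrite /= drop0.
- by rewrite mem_iota /= => iL; apply: dL; rewrite mem_iota.
  split=> [|i]; first by have := dL 0 isT; rewrite /= drop0.
  rewrite mem_iota /= => iL; apply: (dL i.+1).
  by rewrite mem_iota.
Qed.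

Hypothesis rule_mono : forall x L L', {subset L <= L'} -> rule x L -> rule x L'.

Lemma derivation_cat L L' : derivation L -> derivation L' -> derivation (L ++ L').
Proof.
move=> dL dL'; elim: L dL => //= x L IH /derivation_cons [rx /IH dLL'].
apply/derivation_cons; split=> //; apply: rule_mono rx => y yL.
by rewrite mem_cat yL.
Qed.

(** The derivations of the premises are concatenated; monotonicity of the rule tolerates the surplus
    entries. *)
Lemma derivable_rule x L : rule x L -> (forall y, y \in L -> derivable y) -> derivable x.
Proof.
move=> rx dL; have [L' sLL' dL'] : exists2 L', {subset L <= L'} & derivation L'.
  elim: L {rx} dL => [|y L IH] dL; first by exists [::].
  have [|L' sL dL'] := IH; first by move=> z zL; apply: dL; rewrite inE zL orbT.
  have [Ly dLy yLy] := dL y (mem_head y L).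
  exists (Ly ++ L'); last exact: derivation_cat.
  move=> z; rewrite inE mem_cat => /orP[/eqP->|/sL->]; rewrite ?yLy ?orbT //.
exists (x :: L'); last exact: mem_head.
by apply/derivation_cons; split=> //; apply: rule_mono rx.
Qed.

Lemma derivable_ind (Q : X -> Prop) :
    (forall x L, rule x L -> (forall y, y \in L -> Q y) -> Q x) ->
  forall x, derivable x -> Q x.
Proof.
move=> ruleQ x [L]; elim: L x => //= y L IH x /derivation_cons [ry dL].
by rewrite inE => /orP[/eqP->|]; [apply: ruleQ ry _ => z; apply: IH | apply: IH].
Qed.

Lemma semidecidable_derivable :
  semidecidable (fun x : X * seq X => rule x.1 x.2) -> semidecidable derivable.
Proof.
move=> srule.
apply: (@semidecidable_iff _ _ (fun x => exists L, derivation L /\ x \in L)).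
  by move=> x; split=> [[L []]|[L]]; exists L.
apply: semidecidable_ex; apply: semidecidable_and; last by semidecidability.
apply: semidecidable_all; last first.
  by apply: computable_iota; computability; apply: computable_size; computability.
apply: (semidecidable_comp srule (f := fun x : X * seq X * nat =>
         (nth x0 x.1.2 x.2, drop x.2.+1 x.1.2))).
computability.
apply: (@computable_ext _ _ _ _ (fun x : X * seq X * nat =>
         nat_rect (fun=> seq X) (behead x.1.2) (fun _ z => behead z) x.2)).
  case=> [[x L] n]; rewrite [LHS]/= [RHS]/=.
  elim: n => [|k IH]; first by rewrite [LHS]/= -drop1.
  by rewrite [LHS]/= IH -drop1 drop_drop add1n.
by computability.
Qed.
End Derivable.

(** * The universal relation *)

Section RecfunInd.
Variable P : recfun -> Prop.
Fixpoint all_prop (hs : seq recfun) : Prop :=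
  if hs is h :: hs' then P h /\ all_prop hs' else True.
Hypotheses (PZero : P Zero) (PSucc : P Succ) (PProj : forall i, P (Proj i))
  (PComp : forall g hs, P g -> all_prop hs -> P (Comp g hs))
  (PPRec : forall g h, P g -> P h -> P (PRec g h)) (PMu : forall g, P g -> P (Mu g)).

(** The generated principle offers no hypothesis for the programmes inside the list of [Comp]. *)
Fixpoint recfun_nested_ind (f : recfun) : P f :=
  match f with
  | Zero => PZero
  | Succ => PSucc
  | Proj i => PProj i
  | Comp g hs => PComp (recfun_nested_ind g)
     ((fix all_ind (hs : seq recfun) : all_prop hs :=
         match hs return all_prop hs with
         | [::] => I
         | h :: hs' => conj (recfun_nested_ind h) (all_ind hs')
         end) hs)
  | PRec g h => PPRec (recfun_nested_ind g) (recfun_nested_ind h)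
  | Mu g => PMu (recfun_nested_ind g)
  end.
End RecfunInd.

Lemma computes_inj f v y y' : computes f v y -> computes f v y' -> y = y'.
Proof.
elim/recfun_nested_ind: f v y y' => [||i|g hs IHg IHhs|g h IHg IHh|g IHg] v y y'.
- by move=> /= -> ->.
- by move=> /= -> ->.
- by move=> /= -> ->.
- rewrite !computesComp => -[ws hws gy] [ws' hws' gy'].
  suff e : ws = ws' by rewrite e in gy; apply: IHg gy gy'.
  elim: hs ws ws' IHhs hws hws' {gy gy'} => [|h hs IH] [|w ws] [|w' ws'] //=.
  move=> [Ph Phs] [hw hws] [hw' hws']; congr (_ :: _); first exact: Ph hw hw'.
  exact: IH hws hws'.
- move=> /=; elim: (head 0 v) y y' => [|n IH] y y'; first exact: IHg.
  by move=> [z /IH ez hz] [z' /ez <-]; apply: IHh.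
- move=> [g0 gS] [g0' gS']; case: (ltngtP y y') => // lt.
    by have [z gz] := gS' _ lt; have := IHg _ _ _ g0 gz.
  by have [z gz] := gS _ lt; have := IHg _ _ _ g0' gz.
Qed.

Fixpoint prog_code (f : recfun) : nat := encode (
  match f with
  | Zero => [:: 0]
  | Succ => [:: 1]
  | Proj i => [:: 2; i]
  | Comp g hs => [:: 3; prog_code g; encode (map prog_code hs)]
  | PRec g h => [:: 4; prog_code g; prog_code h]
  | Mu g => [:: 5; prog_code g]
  end).

(* A fact (e, v, y) says that the program coded by e maps v to y.  The tags 6
   and 7 are auxiliary programs: [:: 6; hs] runs a list of programs, and
   [:: 7; g] relates v to y when g (i, v) is defined and nonzero for i < y. *)
Definition fact : eqType := (nat * seq nat * nat)%type.

(** One disjunct per clause of [computes], positive in L. Running a programme becomes a search for a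
    derivation, so no evaluator with fuel is required. *)
Definition computation_rule (x : fact) (L : seq fact) : Prop :=
     (x.1.1 = encode [:: 0] /\ x.2 = 0)
  \/ (x.1.1 = encode [:: 1] /\ x.2 = (head 0 x.1.2).+1)
  \/ (exists i, x.1.1 = encode [:: 2; i] /\ x.2 = nth 0 x.1.2 i)
  \/ (exists g hs (ws : seq nat), x.1.1 = encode [:: 3; g; hs] /\
        (encode [:: 6; hs], x.1.2, encode ws) \in L /\ (g, ws, x.2) \in L)
  \/ (exists g h, x.1.1 = encode [:: 4; g; h] /\
        head 0 x.1.2 = 0 /\ (g, behead x.1.2, x.2) \in L)
  \/ (exists g h n z, x.1.1 = encode [:: 4; g; h] /\ head 0 x.1.2 = n.+1 /\
        (x.1.1, n :: behead x.1.2, z) \in L /\ (h, [:: n, z & behead x.1.2], x.2) \in L)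
  \/ (exists g, x.1.1 = encode [:: 5; g] /\
        (g, x.2 :: x.1.2, 0) \in L /\ (encode [:: 7; g], x.1.2, x.2) \in L)
  \/ (x.1.1 = encode [:: 6; encode ([::] : seq nat)] /\ x.2 = encode ([::] : seq nat))
  \/ (exists h (hs : seq nat) w (ws : seq nat), x.1.1 = encode [:: 6; encode (h :: hs)] /\
        x.2 = encode (w :: ws) /\ (h, x.1.2, w) \in L /\
        (encode [:: 6; encode hs], x.1.2, encode ws) \in L)
  \/ (exists g, x.1.1 = encode [:: 7; g] /\ x.2 = 0)
  \/ (exists g i z, x.1.1 = encode [:: 7; g] /\ x.2 = i.+1 /\
        (g, i :: x.1.2, z.+1) \in L /\ (x.1.1, x.1.2, i) \in L).

Lemma computation_rule_mono x L L' :
  {subset L <= L'} -> computation_rule x L -> computation_rule x L'.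
Proof.
move=> sL; rewrite /computation_rule; have sL' y : y \in L -> y \in L' := sL y.
move=> R; repeat (case: R => R; [left | right]);
  by decompose [ex and] R; clear R; repeat eexists; eauto.
Qed.

Lemma semidecidable_computation_rule :
  semidecidable (fun x : fact * seq fact => computation_rule x.1 x.2).
Proof. by rewrite /computation_rule; semidecidability. Qed.

Definition yields (e : nat) (v : seq nat) (y : nat) : Prop :=
  derivable computation_rule (e, v, y).

Lemma encode_inj {A} {eA : encoding A} : injective (@encode A eA).
Proof. exact: can_inj encodeK. Qed.

Definition prog_list (f : recfun) : seq nat :=
  match f with
  | Zero => [:: 0]
  | Succ => [:: 1]
  | Proj i => [:: 2; i]
  | Comp g hs => [:: 3; prog_code g; encode (map prog_code hs)]
  | PRec g h => [:: 4; prog_code g; prog_code h]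
  | Mu g => [:: 5; prog_code g]
  end.

Lemma prog_codeE f : prog_code f = encode (prog_list f).
Proof. by case: f. Qed.

(** The invariant of the soundness proof, one clause for each sort of code. About a number that is
    none of these codes it claims nothing. *)
Definition fact_holds (x : fact) : Prop :=
  [/\ forall f, x.1.1 = prog_code f -> computes f x.1.2 x.2,
      forall hs, x.1.1 = encode [:: 6; encode (map prog_code hs)] ->
        computes_all x.1.2 hs (decode x.2)
    & forall g, x.1.1 = encode [:: 7; prog_code g] ->
        forall i, i < x.2 -> exists z, computes g (i :: x.1.2) z.+1].

Lemma derivable_fact_holds x : derivable computation_rule x -> fact_holds x.
Proof.
apply: (derivable_ind (Q := fact_holds)) x => -[[e v] y] L.
rewrite /computation_rule /fact_holds => R QL.
have QL1 f v' y' : (prog_code f, v', y') \in L -> computes f v' y'.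
  by move=> /QL [/(_ _ erefl)].
have QL2 hs v' (ws : seq nat) :
    (encode [:: 6; encode (map prog_code hs)], v', encode ws) \in L -> computes_all v' hs ws.
  by move=> /QL [_ /(_ _ erefl)] /=; rewrite encode_seqK.
have QL3 g v' y' : (encode [:: 7; prog_code g], v', y') \in L ->
    forall i, i < y' -> exists z, computes g (i :: v') z.+1.
  by move=> /QL [_ _ /(_ _ erefl)].
have inj := @encode_inj (seq nat) _.
cbn [fst snd] in R; split=> [f|hs|g] ef; cbn [fst snd] in ef |- *; subst e.
- rewrite prog_codeE in R; case: f R => [||i|g hs|g h|g] R.
  all: decompose [or ex and] R; clear R.
  all: match goal with H : encode _ = encode _ |- _ => move/inj: H => H end.
  all: try discriminate.
  all: try match goal with H : prog_list _ = _ |- _ => injection H; clear H end.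
  all: intros; subst.
  all: try by [].
  + by rewrite computesComp; eexists; [apply: QL2; eassumption | apply: QL1; eassumption].
  + by match goal with H : head 0 _ = _ |- _ => rewrite /= H end; apply: QL1.
  + match goal with H : head 0 _ = _, H' : context [prog_list _] |- _ =>
      rewrite -prog_codeE in H'; move/QL1: H' => /= H'; rewrite /= H end.
    by eexists; [eassumption | apply: QL1].
  + by split; [apply: QL1 | apply: QL3; eassumption].
+ have /inj : encode (map prog_code hs) = encode ([::] : seq nat) by case: H.
  by case: hs {H}.
+ have /inj : encode (map prog_code hs) = encode (x :: x0) by case: H0.
  case: hs {H0} => // h' hs' [ex ex0]; subst x x0; rewrite (@encodeK (seq nat) _).
  by split; [apply: QL1 | apply: QL2].
move: H0 H2 => [eg]; subst x; rewrite ltnS leq_eqVlt => /orP[/eqP->|].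
  by eexists; apply: QL1; eassumption.
by apply: QL3; eassumption.
Qed.

Lemma yields_sound f v y : yields (prog_code f) v y -> computes f v y.
Proof. by case/derivable_fact_holds => /(_ f erefl). Qed.

Lemma yields_rule e v y L : computation_rule (e, v, y) L ->
  (forall x : fact, x \in L -> derivable computation_rule x) -> yields e v y.
Proof. by apply: derivable_rule; apply: computation_rule_mono. Qed.

Lemma yields_rule0 e v y : computation_rule (e, v, y) [::] -> yields e v y.
Proof. by move/yields_rule; apply. Qed.

Lemma yields_rule2 e v y (x1 x2 : fact) : computation_rule (e, v, y) [:: x1; x2] ->
  derivable computation_rule x1 -> derivable computation_rule x2 -> yields e v y.
Proof.
move=> /yields_rule + d1 d2; apply=> x; rewrite !inE.
by case/orP => /eqP->.
Qed.

Lemma yields_complete f v y : computes f v y -> yields (prog_code f) v y.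
Proof.
elim/recfun_nested_ind: f v y => [||i|g hs IHg IHhs|g h IHg IHh|g IHg] v y.
- by move=> e; apply: yields_rule0; left; split.
- by move=> e; apply: yields_rule0; right; left; split.
- by move=> e; apply: yields_rule0; do 2 right; left; exists i; split.
- rewrite computesComp => -[ws hws /IHg dg].
  apply: (@yields_rule2 _ _ _ (encode [:: 6; encode (map prog_code hs)], v, encode ws)
    (prog_code g, ws, y)) => //.
    do 3 right; left; exists (prog_code g), (encode (map prog_code hs)), ws.
    by rewrite !inE !eqxx orbT.
  elim: hs ws IHhs hws {dg} => [|h hs IH] [|w ws] hsP hws; try by case: hws.
    by apply: yields_rule0; do 7 right; left.
  case: hsP hws => Ph Phs [/Ph dh hws].
  apply: (yields_rule2 _ dh (IH ws Phs hws)).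
  do 8 right; left; exists (prog_code h), (map prog_code hs), w, ws.
  by rewrite !inE !eqxx orbT.
- rewrite [computes _ _ _]/= -/computes.
  (* Primitive recursion changes only the head of v: the tail is frozen as b, and v itself varies in
     the induction. *)
  have [b eb] : exists b, behead v = b by exists (behead v).
  have [n en] : exists n, head 0 v = n by exists (head 0 v).
  rewrite eb en; elim: n v eb en y => [|n IH] v eb en y.
    move=> /IHg dg; apply: (yields_rule2 (x1 := (_, _, _)) _ dg dg).
    by do 4 right; left; exists (prog_code g), (prog_code h); rewrite eb en !inE !eqxx.
  case=> z zP /IHh dh; have dz := IH (n :: b) erefl erefl z zP.
  apply: (yields_rule2 (x1 := (_, _, _)) _ dz dh).
  do 5 right; left; exists (prog_code g), (prog_code h), n, z.
  by rewrite eb en !inE !eqxx orbT.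
- move=> [/IHg d0 dS].
  apply: (@yields_rule2 _ _ _ (prog_code g, y :: v, 0) (encode [:: 7; prog_code g], v, y)) => //.
    by do 6 right; left; exists (prog_code g); rewrite !inE !eqxx orbT.
  elim: y {d0} dS => [|i IH] dS.
    by apply: yields_rule0; do 9 right; left; exists (prog_code g).
  have [z /IHg dz] := dS i (ltnSn i).
  have /IH di j : j < i -> exists z, computes g (j :: v) z.+1.
    by move=> /ltnW; apply: dS.
  apply: (yields_rule2 _ dz di); do 10 right; exists (prog_code g), i, z.
  by rewrite !inE !eqxx orbT.
Qed.

Lemma yieldsP f v y : yields (prog_code f) v y <-> computes f v y.
Proof. by split; [apply: yields_sound | apply: yields_complete]. Qed.

Lemma semidecidable_yields :
  semidecidable (fun x : nat * seq nat * nat => yields x.1.1 x.1.2 x.2).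
Proof.
have /semidecidable_iff : forall x : fact,
  derivable computation_rule x <-> yields x.1.1 x.1.2 x.2 by move=> [[]].
by apply; apply: semidecidable_derivable semidecidable_computation_rule.
Qed.

(** Minimisation over certificates: the test is total, so [Mu] halts exactly when a certificate
    exists. *)
Lemma semidecidable_recursively_enumerable m (P : seq nat -> Prop) :
  semidecidable P -> recursively_enumerable (fun w : word m => P (map (@letter_code m) w)).
Proof.
move=> [F cF FP].
pose D := @decode (seq nat) (@seq_encoding nat nat_encoding).
pose G (v : seq nat) := if F (D (nth 0 v 1), nth 0 v 0) then 0 else 1.
have [g gG] : recursive G.
  have r := recursive3_comp recursive3_if (recursive1_comp (computableE cF)
    (recursive2_comp recursive2_cons (recursive_nth 1) (recursive_nth 0)))
    (recursive_const 0) (recursive_const 1).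
  apply: recursive_ext r => v.
  by rewrite /= /decode_pair head_cons behead_cons /G; case: (F _).
have dw (w : word m) : D (word_code w) = map (@letter_code m) w.
  by rewrite /D /word_code /= /decode_seq CodeSeq.codeK map_id.
exists (Mu g) => w; rewrite FP; split=> [[c Fc]|[c [g0 _]]]; last first.
  exists c; have := computes_inj (gG _) g0.
  by rewrite /G [nth _ _ _]/= [nth _ _ 0]/= dw; case: (F _).
have exF : exists c, F (map (@letter_code m) w, c) by exists c.
exists (ex_minn exF); case: ex_minnP => y Fy ymin; split=> [|i ltiy].
  have := gG [:: y; word_code w].
  by rewrite /G [nth _ _ _]/= [nth _ _ 0]/= dw Fy.
exists 0; have := gG [:: i; word_code w].
rewrite /G [nth _ _ _]/= [nth _ _ 0]/= dw; case: ifP => // /ymin.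
by rewrite leqNgt ltiy.
Qed.

(** * Groups of words modulo a congruence *)

(** A congruence of the free monoid that contains the cancellations is a normal subgroup of the free
    group in disguise; the free group itself is never built. *)
Record word_congruence (m : nat) := WordCongruence {
  cong :> rel (word m);
  cong_refl : reflexive cong;
  cong_sym : symmetric cong;
  cong_trans : transitive cong;
  cong_cat : forall u v w1 w2, cong w1 w2 -> cong (u ++ w1 ++ v) (u ++ w2 ++ v);
  cong_cancel : forall l w, cong [:: l, inv_letter l & w] w }.

Section WordQuotient.
Variables (m : nat) (C : word_congruence m).

Canonical cong_equiv := EquivRel (cong C) (@cong_refl _ C) (@cong_sym _ C) (@cong_trans _ C).

Definition word_quotient := {eq_quot cong C}%qT.
HB.instance Definition _ := Choice.on word_quotient.

Definition word_class (w : word m) : word_quotient := (\pi_({eq_quot cong C}) w)%qT.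
Definition class_word (x : word_quotient) : word m := generic_quotient.repr (x : {eq_quot cong C}%qT).

Lemma class_wordK : cancel class_word word_class.
Proof. by move=> x; rewrite /word_class /class_word reprK. Qed.

Lemma word_classP w1 w2 : word_class w1 = word_class w2 <-> C w1 w2.
Proof. by split=> [/eqmodP|H]; [|apply/eqmodP]. Qed.

Lemma class_word_class w : C (class_word (word_class w)) w.
Proof. by apply/word_classP; rewrite class_wordK. Qed.

Lemma cong_catl u w1 w2 : C w1 w2 -> C (u ++ w1) (u ++ w2).
Proof. by move/(cong_cat u [::]); rewrite !cats0. Qed.

Lemma cong_catr v w1 w2 : C w1 w2 -> C (w1 ++ v) (w2 ++ v).
Proof. exact: (cong_cat [::] v). Qed.

Lemma cong_cat2 u1 u2 w1 w2 : C u1 u2 -> C w1 w2 -> C (u1 ++ w1) (u2 ++ w2).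
Proof.
by move=> cu cw; apply: (cong_trans (y := u1 ++ w2)); [apply: cong_catl|apply: cong_catr].
Qed.

Definition inv_word (w : word m) : word m := rev (map (@inv_letter m) w).

Lemma inv_letterK : involutive (@inv_letter m).
Proof. by case=> i b; rewrite /inv_letter negbK. Qed.

Lemma inv_wordK : involutive inv_word.
Proof. by move=> w; rewrite /inv_word map_rev revK (mapK inv_letterK). Qed.

Lemma cong_mulwV w : C (w ++ inv_word w) [::].
Proof.
elim/last_ind: w => [|w l IH]; first exact: cong_refl.
rewrite /inv_word map_rcons rev_rcons -cats1 -catA /=.
exact: cong_trans (cong_catl w (cong_cancel C l _)) IH.
Qed.

Lemma cong_mulVw w : C (inv_word w ++ w) [::].
Proof. by rewrite -{2}[w]inv_wordK cong_mulwV. Qed.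

Definition wq_mul (x y : word_quotient) := word_class (class_word x ++ class_word y).
Definition wq_inv (x : word_quotient) := word_class (inv_word (class_word x)).

Lemma word_class_cat u v : word_class (u ++ v) = wq_mul (word_class u) (word_class v).
Proof.
by apply/word_classP/cong_cat2; rewrite cong_sym; apply: class_word_class.
Qed.

Lemma wq_mulA : associative wq_mul.
Proof.
move=> x y z; rewrite -[x]class_wordK -[y]class_wordK -[z]class_wordK.
by rewrite -!word_class_cat catA.
Qed.

Lemma wq_mul1 : left_id (word_class [::]) wq_mul.
Proof. by move=> x; rewrite -[x]class_wordK -word_class_cat. Qed.

Lemma wq_mulr1 : right_id (word_class [::]) wq_mul.
Proof. by move=> x; rewrite -[x]class_wordK -word_class_cat cats0. Qed.

Lemma wq_mulV : left_inverse (word_class [::]) wq_inv wq_mul.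
Proof.
move=> x; rewrite -{2}[x]class_wordK -word_class_cat; apply/word_classP.
exact: cong_mulVw.
Qed.

Lemma wq_mulrV : right_inverse (word_class [::]) wq_inv wq_mul.
Proof.
move=> x; rewrite -{1}[x]class_wordK -word_class_cat; apply/word_classP.
exact: cong_mulwV.
Qed.

HB.instance Definition _ := isGroup.Build word_quotient
  wq_mulA wq_mul1 wq_mulr1 wq_mulV wq_mulrV.

Local Open Scope group_scope.

Lemma word_class1 : word_class [::] = 1. Proof. by []. Qed.

Lemma word_classM u v : word_class (u ++ v) = word_class u * word_class v.
Proof. exact: word_class_cat. Qed.

Lemma word_classV w : word_class (inv_word w) = (word_class w)^-1.
Proof.
apply: (mulgI (word_class w)); rewrite mulgV -word_classM -word_class1.
exact/word_classP/cong_mulwV.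
Qed.

Lemma word_class_eq1 w : word_class w = 1 <-> C w [::].
Proof. by rewrite -word_class1; apply: word_classP. Qed.

Definition wq_gen (i : 'I_m) : word_quotient := word_class [:: (i, false)].

Lemma word_val_wq_gen w : word_val wq_gen w = word_class w.
Proof.
elim: w => [|[i b] w IH]; first by rewrite /word_val big_nil.
rewrite /word_val big_cons -/(word_val _ _) IH -cat1s word_classM.
by case: b => //=; rewrite -word_classV.
Qed.

Lemma generates_wq_gen : generates wq_gen.
Proof. by move=> g; exists (class_word g); rewrite word_val_wq_gen class_wordK. Qed.

(** All words congruent to the empty one serve as relators. Then w1 becomes w2 by inserting
    [inv_word w2 ++ w2] and deleting [w1 ++ inv_word w2]. *)
Lemma wq_recursively_presented :
  recursively_enumerable (fun w => C w [::]) -> recursively_presented word_quotient.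
Proof.
move=> reC; exists m, wq_gen, (fun w => C w [::]); split=> //; split.
  exact: generates_wq_gen.
move=> w1 w2; rewrite !word_val_wq_gen; split=> [e|]; last first.
  elim=> {w1 w2} // [w1 w2 w3 _ -> _ -> //|u v l|u v r Cr].
    by apply/word_classP/cong_catl; apply: cong_cancel.
  by apply/word_classP/cong_catl; apply: (cong_catr v Cr).
pose R w := is_true (C w [::]).
apply: (@RelTrans _ _ _ (w1 ++ inv_word w2 ++ w2)).
  rewrite -{1}[w1]cats0; apply: RelSym.
  have R1 : R (inv_word w2 ++ w2) by apply: cong_mulVw.
  by have := RelRelator w1 [::] R1; rewrite !cats0.
have R2 : R (w1 ++ inv_word w2).
  by apply/word_class_eq1; rewrite word_classM word_classV e mulgV.
by have := RelRelator [::] w2 R2; rewrite /= -catA.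
Qed.

End WordQuotient.

(** * Finite quotients from congruences of finite index *)

Section FiniteIndex.
Variables (m : nat) (C D : word_congruence m) (T : finType) (h : word m -> T).
Hypothesis sub_cong : forall w1 w2, C w1 w2 -> D w1 w2.
Hypothesis index_cong : forall w1 w2, h w1 = h w2 -> D w1 w2.

(** h need not be constant on D-classes, so a class is named by a value picked among those that h
    takes on it; this set of values depends only on the class. *)
Definition class_index (w : word m) : option T :=
  [pick t | `[< exists2 w', D w' w & h w' = t >]].

Lemma class_indexP w1 w2 : class_index w1 = class_index w2 <-> D w1 w2.
Proof.
split=> [|Dw]; last first.
  rewrite /class_index; apply: eq_pick => t; apply: asbool_equiv_eq; split=> -[w Dw' hw].
    by exists w => //; apply: cong_trans Dw' Dw.
  by exists w => //; rewrite cong_sym in Dw; apply: cong_trans Dw' Dw.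
rewrite /class_index; case: pickP => [t /asboolP [w Dw hw]|none] e; last first.
  by have /asboolP [] := none (h w1); exists w1 => //; apply: cong_refl.
move: e; case: pickP => // t' /asboolP [w' Dw' hw'] [et].
rewrite cong_sym in Dw; apply: cong_trans Dw (cong_trans (index_cong _) Dw').
by rewrite hw hw' et.
Qed.

(** Right multiplication on the D-classes, transported to their names and extended by the identity
    to the elements that name no class. It yields a finite quotient as a permutation group. *)
Definition act_index (u : word m) (x : option T) : option T :=
  if pselect (exists v, class_index v = x) is left ex then class_index (projT1 (cid ex) ++ u)
  else x.

Lemma act_class_index u v : act_index u (class_index v) = class_index (v ++ u).
Proof.
rewrite /act_index; case: pselect => [ex|[]]; last by exists v.
by case: cid => v' /= /class_indexP Dv; apply/class_indexP; apply: cong_catr.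
Qed.

Lemma act_index_cat u v x : act_index v (act_index u x) = act_index (u ++ v) x.
Proof.
have [[w <-]|no] := pselect (exists w, class_index w = x).
  by rewrite !act_class_index catA.
by rewrite {2 3}/act_index; case: pselect => // _; rewrite /act_index; case: pselect.
Qed.

Lemma act_index_cong u v : D u v -> act_index u =1 act_index v.
Proof.
move=> Duv x; rewrite /act_index; case: pselect => // ex.
by apply/class_indexP; apply: cong_catl.
Qed.

Lemma act_index0 : act_index [::] =1 id.
Proof.
move=> x; rewrite /act_index; case: pselect => // ex; case: cid => v /= <-.
by rewrite cats0.
Qed.

Lemma act_index_inj u : injective (act_index u).
Proof.
apply: (can_inj (g := act_index (inv_word u))) => x.
by rewrite act_index_cat (act_index_cong (cong_mulwV D u)) act_index0.
Qed.

Definition wq_perm (x : word_quotient C) : {perm option T} :=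
  perm (act_index_inj (u := class_word x)).

Lemma wq_perm_class w y : wq_perm (word_class C w) y = act_index w y.
Proof. by rewrite permE; apply/act_index_cong/sub_cong/class_word_class. Qed.

Lemma wq_permM : {morph wq_perm : x y / (x * y)%g}.
Proof.
move=> x y; apply/permP => z; rewrite permM -[x]class_wordK -[y]class_wordK.
by rewrite -word_classM !wq_perm_class act_index_cat.
Qed.

HB.instance Definition _ := isMultiplicative.Build (word_quotient C) {perm option T}
  wq_perm wq_permM.

Lemma wq_finite_quotient w : ~~ D w [::] ->
  exists (Q : finGroupType) (f : {multiplicative word_quotient C -> Q}), f (word_class C w) <> 1%g.
Proof.
move=> nDw; exists {perm option T}, wq_perm => /permP /(_ (class_index [::])).
by rewrite wq_perm_class act_class_index perm1 => /class_indexP; apply/negP.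
Qed.
End FiniteIndex.

(** * Countable elementary abelian groups *)

Section ElementaryAbelian.
Variables (p : nat) (p_prime : prime p) (G : groupType) (N : {pred G}).
Hypothesis N_closed : group_closed N.
Hypothesis N_comm : forall x y, x \in N -> y \in N -> (x * y = y * x)%g.
Hypothesis N_exp : forall x, x \in N -> (x ^+ p = 1)%g.

Let N1 : 1%g \in N. Proof. by case: N_closed. Qed.
Let NM x y : x \in N -> y \in N -> (x * y)%g \in N.
Proof. exact: (group_closedM N_closed). Qed.
Let NX x n : x \in N -> (x ^+ n)%g \in N.
Proof. by move=> Nx; elim: n => // n IH; rewrite expgS NM. Qed.

Let Zp_p : (Zp_trunc p).+2 = p. Proof. exact/Zp_cast/prime_gt1. Qed.

Lemma expg_modn x n : x \in N -> (x ^+ (n %% p) = x ^+ n)%g.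
Proof.
move=> Nx; rewrite {2}(divn_eq n p) expgnDr mulnC expgnA (N_exp Nx) expg1n.
by rewrite mul1g.
Qed.

Lemma expg_ZpD x (c d : 'Z_p) : x \in N -> (x ^+ (c + d)%R = x ^+ c * x ^+ d)%g.
Proof.
move=> Nx; rewrite -expgnDr -(expg_modn (c + d) Nx); congr (_ ^+ _)%g.
by rewrite /=; congr (_ %% _).
Qed.

Lemma expg_ZpM x (c d : 'Z_p) : x \in N -> (x ^+ (c * d)%R = x ^+ c ^+ d)%g.
Proof.
move=> Nx; rewrite -expgnA -(expg_modn (c * d) Nx); congr (_ ^+ _)%g.
by rewrite /=; congr (_ %% _).
Qed.

(** A linear combination in multiplicative notation. G is not assumed abelian, so the order of the
    factors is fixed, and they are rearranged only inside N. *)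
Definition lincomb (b : nat -> G) (n : nat) (a : nat -> 'Z_p) : G :=
  (\prod_(i < n) b i ^+ a i)%g.

Lemma lincombS b n a : lincomb b n.+1 a = (lincomb b n a * b n ^+ a n)%g.
Proof. by rewrite /lincomb big_ord_recr. Qed.

Lemma lincomb0 b a : lincomb b 0 a = 1%g.
Proof. by rewrite /lincomb big_ord0. Qed.

Lemma eq_lincomb b b' n a a' :
  (forall i, i < n -> b i = b' i) -> (forall i, i < n -> a i = a' i) ->
  lincomb b n a = lincomb b' n a'.
Proof. by move=> eb ea; apply: eq_bigr => i _; rewrite eb ?ea. Qed.

Lemma lincomb_widen b n n' a : n <= n' -> (forall i, n <= i -> a i = 0%R) ->
  lincomb b n' a = lincomb b n a.
Proof.
move=> + a0; elim: n' => [|n' IH]; first by rewrite leqn0 => /eqP->.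
rewrite leq_eqVlt => /orP[/eqP-> //|]; rewrite ltnS => le_nn'.
by rewrite lincombS IH // (a0 _ le_nn') expg0 mulg1.
Qed.

Section Basis.
Variable b : nat -> G.
Hypothesis Nb : forall i, b i \in N.

Lemma lincomb_in n a : lincomb b n a \in N.
Proof. by elim: n => [|n IH]; rewrite ?lincomb0 // lincombS NM ?NX. Qed.

Lemma lincombD n (a a' : nat -> 'Z_p) :
  lincomb b n (fun i => a i + a' i)%R = (lincomb b n a * lincomb b n a')%g.
Proof.
elim: n => [|n IH]; first by rewrite !lincomb0 mulg1.
rewrite !lincombS IH expg_ZpD // -!mulgA; congr mul; rewrite !mulgA; congr mul.
by apply: N_comm; rewrite ?lincomb_in ?NX.
Qed.

Lemma lincombZ n (a : nat -> 'Z_p) (c : 'Z_p) :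
  lincomb b n (fun i => a i * c)%R = (lincomb b n a ^+ c)%g.
Proof.
elim: n => [|n IH]; first by rewrite !lincomb0 expg1n.
rewrite !lincombS IH expg_ZpM // expgMn //.
by apply: N_comm; rewrite ?lincomb_in ?NX.
Qed.

Hypothesis b_free : forall n, ~ exists a, b n = lincomb b n a.

(** Freeness is given in triangular form: no b n is a combination of earlier ones. A nonzero last
    coefficient is invertible modulo p, and dividing by it would express b n through its
    predecessors. *)
Lemma lincomb_eq1 n a : lincomb b n a = 1%g -> forall i, i < n -> a i = 0%R.
Proof.
elim: n => // n IH; rewrite lincombS => e.
have an0 : a n = 0%R.
  apply/eqP/negPn/negP => an0; apply: (b_free (n := n)).
  have uan : a n \is a GRing.unit.
    rewrite -(natr_Zp (a n)) unitZpE ?prime_gt1 // prime_coprime //.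
    apply: contra an0 => /dvdn_leq; rewrite -val_eqE /=.
    case: (nat_of_ord (a n)) (ltn_ord (a n)) => // k; rewrite Zp_p => ltkp /(_ isT).
    by rewrite leqNgt ltkp.
  exists (fun i => a i * - (a n)^-1)%R; rewrite lincombZ.
  have -> : lincomb b n a = ((b n ^+ a n)^-1)%g by rewrite -[LHS](mulgK (b n ^+ a n)%g) e mul1g.
  rewrite expVgn -expg_ZpM // GRing.mulrN GRing.divrr //.
  have := expg_ZpD (-1)%R 1%R (Nb n); rewrite GRing.addNr expg0 expg1 => e1.
  by apply: (mulgI (b n ^+ (-1 : 'Z_p)%R)%g); rewrite mulgV -e1.
move=> i; rewrite ltnS leq_eqVlt => /orP[/eqP-> //|]; apply: IH.
by rewrite an0 expg0 mulg1 in e.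
Qed.

Lemma lincomb_inj n a a' :
  lincomb b n a = lincomb b n a' -> forall i, i < n -> a i = a' i.
Proof.
move=> e i ltin; apply/eqP; rewrite -GRing.subr_eq0; apply/eqP.
apply: (@lincomb_eq1 n (fun i => a i - a' i)%R) => //.
apply: (mulIg (lincomb b n a')); rewrite -lincombD mul1g -e.
by apply: eq_lincomb => // j _; rewrite GRing.subrK.
Qed.
End Basis.

Variable en : nat -> G.
Hypothesis en_surj : forall g, g \in N -> exists k, en k = g.
Hypothesis N_inf : forall s : seq G, exists2 g, g \in N & g \notin s.

Definition new_index (s : seq G) k :=
  en k \in N /\ ~ exists a, en k = lincomb (nth 1%g s) (size s) a.

(** A finite list has only finitely many combinations, and N is infinite. Taking the least new index
    at each stage builds a basis greedily from the enumeration. *)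
Lemma ex_new_index s : exists k, new_index s k /\ forall j, j < k -> ~ new_index s j.
Proof.
have exk : exists k, `[< new_index s k >].
  have [g Ng gs] := N_inf [seq lincomb (nth 1%g s) (size s)
    (fun i => if insub i is Some i' then f i' else 0%R) | f : {ffun 'I_(size s) -> 'Z_p}].
  have [k ek] := en_surj Ng; exists k; apply/asboolP; split; rewrite ek // => -[a ga].
  move/negP: gs; apply; apply/mapP; exists [ffun i : 'I_(size s) => a i]; first by rewrite mem_enum.
  by rewrite ga; apply: eq_lincomb => // i ltis; rewrite insubT ffunE.
exists (ex_minn exk); case: ex_minnP => k /asboolP kP kmin; split=> // j ltjk jP.
by have := kmin j (asboolT jP); rewrite leqNgt ltjk.
Qed.

Definition next_index s := projT1 (cid (ex_new_index s)).
Definition basis_prefix n := iter n (fun s => rcons s (en (next_index s))) [::].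
Definition basis_elt n := en (next_index (basis_prefix n)).

Lemma size_basis_prefix n : size (basis_prefix n) = n.
Proof. by elim: n => //= n IH; rewrite size_rcons IH. Qed.

Lemma nth_basis_prefix n i : i < n -> nth 1%g (basis_prefix n) i = basis_elt i.
Proof.
elim: n => // n IH; rewrite ltnS /= nth_rcons size_basis_prefix.
by case: ltngtP => // [/IH //|-> _].
Qed.

Lemma basis_eltP n : [/\ basis_elt n \in N,
  ~ exists a, basis_elt n = lincomb basis_elt n a
  & forall j, j < next_index (basis_prefix n) -> en j \in N ->
      exists a, en j = lincomb basis_elt n a].
Proof.
rewrite /basis_elt -/basis_elt /next_index; case: cid => k [[Nk kP] kmin] /=.
have e a : lincomb (nth 1%g (basis_prefix n)) (size (basis_prefix n)) a = lincomb basis_elt n a.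
  by rewrite size_basis_prefix; apply: eq_lincomb => // i; apply: nth_basis_prefix.
split=> // [[a ka]|j ltjk Nj]; first by apply: kP; exists a; rewrite e.
have [//|no] := pselect (exists a, en j = lincomb basis_elt n a).
by case: (kmin j ltjk); split=> // -[a ja]; apply: no; exists a; rewrite -e.
Qed.

(** The chosen indices increase strictly, so stage k.+1 chooses an index above k; by minimality the
    k-th element of the enumeration is then a combination of the first k.+1 basis elements. *)
Lemma lincomb_surj g : g \in N -> exists n a,
  (forall i, n <= i -> a i = 0%R) /\ g = lincomb basis_elt n a.
Proof.
move=> Ng; have [k ek] := en_surj Ng.
(* An equal index would repeat [basis_elt n], and a smaller one would, by minimality at stage n,
   already lie in the earlier span; both contradict freeness at stage n.+1. *)
have inc n : next_index (basis_prefix n) < next_index (basis_prefix n.+1).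
  rewrite ltnNge; apply/negP => le.
  have [N1' no1 _] := basis_eltP n.+1; apply: no1.
  have [_ _ small] := basis_eltP n; rewrite leq_eqVlt in le.
  case/orP: le => [/eqP e|lt].
    exists (fun i => if i == n then 1%R else 0%R).
    rewrite /basis_elt e -/(basis_elt n) lincombS eqxx.
    rewrite {1}/lincomb big1 ?mul1g // => i _.
    by rewrite (ltn_eqF (ltn_ord i)) expg0.
  have [a ja] := small _ lt N1'; exists (fun i => if i < n then a i else 0%R).
  rewrite lincombS ltnn expg0 mulg1 /basis_elt ja.
  by apply: eq_lincomb => // i ->.
have ge n : n <= next_index (basis_prefix n).
  by elim: n => // n IH; apply: leq_ltn_trans IH (inc n).
have [_ _ /(_ k)] := basis_eltP k.+1.
have lt : k < next_index (basis_prefix k.+1) by apply: ge.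
rewrite ek => /(_ lt Ng) [a ga]; exists k.+1, (fun i => if i < k.+1 then a i else 0%R).
split=> [i|]; first by rewrite leqNgt => /negPf->.
by rewrite ga; apply: eq_lincomb => // i ->.
Qed.

Lemma finite_support_bound (a : nat -> 'Z_p) :
  finite_set [set i | a i <> 0%R]%classic <-> exists n, forall i, n <= i -> a i = 0%R.
Proof.
split=> [/finite_seqP [s es]|[n a0]]; last first.
  apply: (sub_finite_set _ (finite_II n)) => i /= ai.
  by rewrite /mkset ltnNge; apply/negP => /a0.
exists (\max_(i <- s) i).+1 => i lti; apply: contrapT => ai.
have : [set` s]%classic i by rewrite -es.
move=> /= si; have := leq_bigmax_seq (P := predT) (F := id) i si isT.
by rewrite leqNgt => /negP; apply.
Qed.

Definition support_bound (a : nat -> 'Z_p) : nat :=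
  if pselect (exists n, forall i, n <= i -> a i = 0%R) is left ex then projT1 (cid ex) else 0.

Lemma support_boundP (a : nat -> 'Z_p) : finite_set [set i | a i <> 0%R]%classic ->
  forall i, support_bound a <= i -> a i = 0%R.
Proof.
move=> /finite_support_bound ex; rewrite /support_bound; case: pselect => // ex'.
by case: cid.
Qed.

Lemma iso_direct_sum_elementary_abelian : iso_direct_sum_Zp p N.
Proof.
pose phi a := lincomb basis_elt (support_bound a) a.
have phiE a n : finite_set [set i | a i <> 0%R]%classic -> support_bound a <= n ->
    phi a = lincomb basis_elt n a.
  by move=> fa lean; rewrite (lincomb_widen _ lean) //; apply: support_boundP.
have Nb i : basis_elt i \in N by case: (basis_eltP i).
exists phi; split; first split.
- by move=> a _; apply: lincomb_in.
- move=> a a'; rewrite !inE => fa fa' e; apply: funext => i.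
  pose n := maxn i.+1 (maxn (support_bound a) (support_bound a')).
  apply: (@lincomb_inj basis_elt Nb _ n).
  + by move=> k; case: (basis_eltP k).
  + by rewrite -!phiE // /n !leq_max leqnn !orbT.
  + by rewrite /n leq_max leqnn.
- move=> g /= Ng; have [n [a [a0 ->]]] := lincomb_surj Ng.
  have fa : finite_set [set i | a i <> 0%R]%classic by apply/finite_support_bound; exists n.
  exists a => //; rewrite (phiE _ (maxn n (support_bound a))) ?leq_maxr //.
  by apply: lincomb_widen; rewrite ?leq_maxl.
- move=> a a' fa fa'.
  have fs : finite_set [set i | (a i + a' i)%R <> 0%R]%classic.
    apply/finite_support_bound; exists (maxn (support_bound a) (support_bound a')) => i.
    rewrite geq_max => /andP[la la'].
    by rewrite (support_boundP fa la) (support_boundP fa' la') GRing.addr0.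
  pose n := maxn (support_bound (fun i => a i + a' i)%R)
                 (maxn (support_bound a) (support_bound a')).
  rewrite (phiE _ n fs) ?(phiE _ n fa) ?(phiE _ n fa') ?lincombD //.
  all: by rewrite /n !leq_max leqnn ?orbT.
Qed.
End ElementaryAbelian.

(** * Values of words in the free algebra *)

Definition letter_poly (p l : nat) (P : seq (seq nat)) : seq (seq nat) :=
  P ++ flatten (nseq (if odd l then p.-1 else 1) (map (cons l./2) P)).

(* The product of the factors 1 + x_i and 1 - x_i named by the letters of the
   word, as a list of monomials; since coefficients only matter modulo p, the
   coefficient -1 is written as p - 1. *)
Definition word_poly (p : nat) (w : seq nat) : seq (seq nat) :=
  foldr (letter_poly p) [:: [::]] w.

Section Series.
Import GRing.Theory.
Local Open Scope ring_scope.
Variables (p : nat) (p_prime : prime p).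
Let F := 'F_p.

Implicit Types (f g : seq nat -> F) (u v : seq nat) (P Q : seq (seq nat)).

Definition coefs P : seq nat -> F := fun u => (count_mem u P)%:R.

Definition lmulX i f : seq nat -> F :=
  fun u => if u is j :: u' then (j == i)%:R * f u' else 0.

Definition rmulX i f : seq nat -> F :=
  fun u => if u is j :: u' then (last j u' == i)%:R * f (belast j u') else 0.

Lemma rmulX_rcons i f u j : rmulX i f (rcons u j) = (j == i)%:R * f u.
Proof. by case: u => //= k u; rewrite last_rcons belast_rcons. Qed.

Lemma natr_Fp_p : p%:R = 0 :> F.
Proof. by rewrite pchar_Fp_0. Qed.

Lemma natr_Fp_pred : p.-1%:R = -1 :> F.
Proof.
by apply/eqP; rewrite -subr_eq0 opprK -mulrSr prednK ?prime_gt0 // natr_Fp_p.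
Qed.

Lemma coefs_cat P Q u : coefs (P ++ Q) u = coefs P u + coefs Q u.
Proof. by rewrite /coefs count_cat natrD. Qed.

Lemma coefs_nseq k P u : coefs (flatten (nseq k P)) u = k%:R * coefs P u.
Proof.
elim: k => [|k IH]; first by rewrite mul0r.
by rewrite /= coefs_cat IH mulrS mulrDl mul1r.
Qed.

Lemma coefs_map_cons i P u : coefs (map (cons i) P) u = lmulX i (coefs P) u.
Proof.
rewrite /coefs count_map; case: u => [|j u] /=.
  by rewrite (eq_count (a2 := pred0)) ?count_pred0.
case: eqVneq => [->|ne]; rewrite ?mul1r ?mul0r.
  by congr (_%:R); apply: eq_count => v /=; rewrite eqseq_cons eqxx.
rewrite (eq_count (a2 := pred0)) ?count_pred0 // => v /=.
by rewrite eqseq_cons eq_sym (negPf ne).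
Qed.

Definition letter_sign (b : bool) : F := if b then -1 else 1.

Lemma coefs_letter_poly l P u :
  coefs (letter_poly p l P) u = coefs P u + letter_sign (odd l) * lmulX l./2 (coefs P) u.
Proof.
rewrite /letter_poly coefs_cat coefs_nseq coefs_map_cons; congr (_ + _ * _).
by rewrite /letter_sign; case: (odd l); rewrite ?natr_Fp_pred.
Qed.

Lemma lmulXE i f u : lmulX i f u = if u is j :: u' then (j == i)%:R * f u' else 0.
Proof. by []. Qed.

Lemma lmulX_rmulX i j f u : lmulX i (rmulX j f) u = rmulX j (lmulX i f) u.
Proof.
case: u => [|k u] //=; case/lastP: u => [|u l] /=; first by rewrite !mulr0.
by rewrite rmulX_rcons last_rcons belast_rcons /= mulrCA.
Qed.
End Series.

Section Words.
Import GRing.Theory.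
Local Open Scope ring_scope.
Variables (p : nat) (p_prime : prime p) (m : nat).
Local Notation F := 'F_p.
Implicit Types (f g : seq nat -> F) (u v : seq nat) (w : word m.+1) (l : letter m.+1).

(* The generator 0 is the module generator t; 1, .., m are x_1, .., x_m. *)
Definition xmon u := all (fun i => (0 < i <= m)%N) u.

(** A value a + t b is read through two coefficient functions: [mon_part false] gives the t-free
    part a, [mon_part true] the t-part b. *)
Definition mon_part (b : bool) u := if b then 0%N :: u else u.

Definition word_series w : seq nat -> F :=
  coefs p (word_poly p (map (@letter_code m.+1) w)).

Lemma letter_code_half l : (letter_code l)./2 = l.1.
Proof. by case: l => i b; rewrite /letter_code /= addnC half_bit_double. Qed.

Lemma letter_code_odd l : odd (letter_code l) = l.2.
Proof. by case: l => i b; rewrite /letter_code /= oddD odd_double; case: b. Qed.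

Lemma word_series0 u : word_series [::] u = (u == [::])%:R.
Proof. by rewrite /word_series /coefs /= addn0 eq_sym. Qed.

Lemma word_series_cons l w u : word_series (l :: w) u =
  word_series w u + letter_sign p l.2 * lmulX l.1 (word_series w) u.
Proof. by rewrite /word_series /= coefs_letter_poly // letter_code_half letter_code_odd. Qed.

Lemma eq_lmulX i f g : f =1 g -> lmulX i f =1 lmulX i g.
Proof. by move=> fg [|j u] //=; rewrite fg. Qed.

(** Values are defined by peeling letters from the left; the mirror recursion holds because left and
    right multiplications commute. *)
Lemma word_series_rcons l w u : word_series (rcons w l) u =
  word_series w u + letter_sign p l.2 * rmulX l.1 (word_series w) u.
Proof.
elim: w u => [|k w IH] u.
  rewrite word_series_cons; congr (_ + _ * _).
  by case: u => [|i [|j u]] //=; rewrite !word_series0 /= ?mulr0.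
rewrite rcons_cons !word_series_cons IH (eq_lmulX _ IH).
set s := letter_sign p k.2; set s' := letter_sign p l.2.
have -> : lmulX k.1 (fun u => word_series w u + s' * rmulX l.1 (word_series w) u) u
    = lmulX k.1 (word_series w) u + s' * lmulX k.1 (rmulX l.1 (word_series w)) u.
  by case: u => [|j u] /=; rewrite ?mulr0 ?addr0 // mulrDr mulrCA.
have -> : rmulX l.1 (word_series (k :: w)) u
    = rmulX l.1 (word_series w) u + s * rmulX l.1 (lmulX k.1 (word_series w)) u.
  case: u => [|j u] /=; rewrite ?mulr0 ?addr0 // word_series_cons mulrDr.
  by rewrite [in X in _ + X]mulrCA.
rewrite lmulX_rmulX !mulrDr !addrA; congr (_ + _); last by rewrite mulrCA.
by rewrite -!addrA; congr (_ + _); rewrite addrC.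
Qed.

Lemma word_series_size w u : (size w < size u)%N -> word_series w u = 0.
Proof.
elim: w u => [|l w IH] u; first by rewrite word_series0; case: u.
move=> /= lt; rewrite word_series_cons IH; last exact: ltnW.
by case: u lt => //= j u lt; rewrite IH ?mulr0 ?addr0.
Qed.

(** A two-sided ideal as a predicate on coefficient functions that sees only monomials without t.
    [ideal_square] makes 1 - x_i inverse to 1 + x_i, [ideal_nil] forbids constant terms, and
    [ideal_trunc] is homogeneity in the form in which it is applied. *)
Record ideal := Ideal {
  in_ideal :> (seq nat -> F) -> Prop;
  ideal_ext : forall f g, (forall u, xmon u -> f u = g u) -> in_ideal f -> in_ideal g;
  ideal0 : in_ideal (fun=> 0);
  idealB : forall f g, in_ideal f -> in_ideal g -> in_ideal (fun u => f u - g u);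
  ideal_lmulX : forall i f, (0 < i <= m)%N -> in_ideal f -> in_ideal (lmulX i f);
  ideal_rmulX : forall i f, (0 < i <= m)%N -> in_ideal f -> in_ideal (rmulX i f);
  ideal_square : forall i P, (0 < i <= m)%N -> in_ideal (lmulX i (lmulX i (coefs p P)));
  ideal_nil : forall f, in_ideal f -> f [::] = 0;
  ideal_trunc : forall D f, in_ideal f ->
    in_ideal (fun u => if (size u <= D)%N then f u else 0) }.

Section IdealTheory.
Variable J : ideal.

Lemma idealN f : J f -> J (fun u => - f u).
Proof.
by move=> /(idealB (ideal0 J)); apply: ideal_ext => u _; rewrite sub0r.
Qed.

Lemma idealD f g : J f -> J g -> J (fun u => f u + g u).
Proof.
move=> Jf /idealN /(idealB Jf); apply: ideal_ext => u _.
by rewrite opprK.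
Qed.

Lemma ideal_sign b f : J f -> J (fun u => letter_sign p b * f u).
Proof.
case: b => [/idealN|]; apply: ideal_ext => u _; by rewrite ?mulN1r ?mul1r.
Qed.

(** With [full] both parts of the value are compared, and the quotient is G; without it only the
    t-free parts are, and the quotient is G / N. *)
Definition word_congr (full : bool) (w1 w2 : word m.+1) : bool :=
  `[< forall b, (b ==> full) ->
      J (fun u => word_series w1 (mon_part b u) - word_series w2 (mon_part b u)) >].

Lemma word_congrP full w1 w2 : reflect (forall b, (b ==> full) ->
    J (fun u => word_series w1 (mon_part b u) - word_series w2 (mon_part b u)))
  (word_congr full w1 w2).
Proof. exact: asboolP. Qed.

Lemma word_congr_refl full : reflexive (word_congr full).
Proof.
move=> w; apply/word_congrP => b _; apply: ideal_ext (ideal0 J) => u _.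
by rewrite subrr.
Qed.

Lemma word_congr_sym full : symmetric (word_congr full).
Proof.
have sym w1 w2 : word_congr full w1 w2 -> word_congr full w2 w1.
  move=> /word_congrP c; apply/word_congrP => b /c /idealN.
  by apply: ideal_ext => u _; rewrite opprB.
by move=> w1 w2; apply/idP/idP; apply: sym.
Qed.

Lemma word_congr_trans full : transitive (word_congr full).
Proof.
move=> w2 w1 w3 /word_congrP c1 /word_congrP c2; apply/word_congrP => b bf.
apply: ideal_ext (idealD (c1 b bf) (c2 b bf)) => u _.
by rewrite addrA subrK.
Qed.

Lemma xmon0 (u : seq nat) k : xmon (k :: u) -> (k == 0%N) = false.
Proof. by case/andP; case: k. Qed.

Lemma lmul0_xmon f u : xmon u -> lmulX 0 f u = 0.
Proof. by case: u => [|k u] // /xmon0 /= ->; rewrite mul0r. Qed.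

Lemma letter_bound l : l.1 != ord0 -> (0 < l.1 <= m)%N.
Proof. by rewrite -val_eqE /= -lt0n => -> /=; rewrite -ltnS. Qed.

Lemma word_congr_cons full l w1 w2 :
  word_congr full w1 w2 -> word_congr full (l :: w1) (l :: w2).
Proof.
move=> /word_congrP c; apply/word_congrP => b bf.
set d := fun u => word_series w1 u - word_series w2 u.
(* A left factor x_i kills the t-part, since x_i t = 0. A left factor t has no t-free part and moves
   the t-free part of d, known to be in J, into the t-part. *)
have cb : J (fun u => lmulX l.1 d (mon_part b u)).
  have [l0|lx] := eqVneq l.1 ord0; last first.
    case: b bf => bf; last exact: ideal_lmulX (letter_bound lx) (c false isT).
    apply: ideal_ext (ideal0 J) => u _ /=.
    by rewrite -[0%N]/(val (@ord0 m)) (inj_eq val_inj) eq_sym (negPf lx) mul0r.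
  case: b bf => bf; last first.
    by apply: ideal_ext (ideal0 J) => u xu; rewrite l0 lmul0_xmon.
  by apply: ideal_ext (c false isT) => u _ /=; rewrite l0 eqxx mul1r.
apply: ideal_ext (idealD (c b bf) (ideal_sign l.2 cb)) => u _.
rewrite !word_series_cons opprD addrACA; congr (_ + _); rewrite -mulrBr; congr (_ * _).
by case: (mon_part b u) => [|k u'] /=; rewrite ?subr0 // mulrBr.
Qed.

Lemma word_congr_rcons full l w1 w2 :
  word_congr full w1 w2 -> word_congr full (rcons w1 l) (rcons w2 l).
Proof.
move=> /word_congrP c; apply/word_congrP => b bf.
set d := fun u => word_series w1 u - word_series w2 u.
(* A right factor x_i acts on both parts. A right factor t retains only the constant term of d, and
   that vanishes by [ideal_nil]. *)
have cb : J (fun u => rmulX l.1 d (mon_part b u)).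
  have [l0|lx] := eqVneq l.1 ord0; last first.
    apply: ideal_ext (ideal_rmulX (letter_bound lx) (c b bf)) => u _.
    case: b {bf} => //; case/lastP: u => [|u j]; last first.
      by rewrite /mon_part -rcons_cons !rmulX_rcons.
    by rewrite /= -[0%N]/(val (@ord0 m)) (inj_eq val_inj) eq_sym (negPf lx) mul0r.
  apply: ideal_ext (ideal0 J) => u xu; rewrite l0.
  case/lastP: u xu => [|u j] xu.
    have /= d0 := ideal_nil (c false isT).
    by case: b {bf} => //=; rewrite /d d0 mulr0.
  have j0 : (j == 0)%N = false.
    by move: xu; rewrite /xmon all_rcons => /andP[]; case: j.
  by case: b {bf}; rewrite /mon_part -?rcons_cons rmulX_rcons j0 mul0r.
apply: ideal_ext (idealD (c b bf) (ideal_sign l.2 cb)) => u _.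
rewrite !word_series_rcons opprD addrACA; congr (_ + _); rewrite -mulrBr; congr (_ * _).
by case: (mon_part b u) => [|k u'] /=; rewrite ?subr0 // mulrBr.
Qed.

Lemma word_congr_cat full (u v w1 w2 : word m.+1) :
  word_congr full w1 w2 -> word_congr full (u ++ w1 ++ v) (u ++ w2 ++ v).
Proof.
move=> c; elim: u => [|l u IH] /=; last exact: word_congr_cons.
elim/last_ind: v => [|v l IH]; first by rewrite !cats0.
by rewrite -!rcons_cat; apply: word_congr_rcons.
Qed.

(** (1 + s x)(1 - s x) = 1 - x^2 for a sign s. If x is some x_i, the square lies in J; if x = t, it
    is dropped because t stands in second place. *)
Lemma word_congr_cancel full l w : word_congr full [:: l, inv_letter l & w] w.
Proof.
apply/word_congrP => b _.
have sq : J (fun u => lmulX l.1 (lmulX l.1 (word_series w)) (mon_part b u)).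
  have [l0|lx] := eqVneq l.1 ord0; last first.
    case: b; last exact: ideal_square (letter_bound lx).
    apply: ideal_ext (ideal0 J) => u _ /=.
    by rewrite -[0%N]/(val (@ord0 m)) (inj_eq val_inj) eq_sym (negPf lx) mul0r.
  apply: ideal_ext (ideal0 J) => u xu; rewrite l0.
  by case: b; rewrite /mon_part; [rewrite lmulXE|]; rewrite lmul0_xmon ?mulr0.
apply: ideal_ext (idealN sq) => u _.
rewrite !word_series_cons /=; set f := word_series w; set s := letter_sign p l.2.
have -> : letter_sign p (~~ l.2) = - s by rewrite /s; case: l.2; rewrite ?opprK.
have ss : s * s = 1 by rewrite /s; case: l.2; rewrite /= ?mulrNN mulr1.
have -> : lmulX l.1 (word_series (inv_letter l :: w)) (mon_part b u) =
    lmulX l.1 f (mon_part b u) - s * lmulX l.1 (lmulX l.1 f) (mon_part b u).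
  case: (mon_part b u) => [|k v] /=; first by rewrite mulr0 subr0.
  rewrite word_series_cons /=.
  have -> : letter_sign p (~~ l.2) = - s by rewrite /s; case: l.2; rewrite ?opprK.
  by rewrite mulrDr mulNr mulrN mulrCA.
rewrite mulrBr mulrA ss mul1r mulNr; set a := f _; set y := s * _.
by rewrite addrA subrK addrAC subrr add0r.
Qed.

Definition ideal_congruence full : word_congruence m.+1 :=
  WordCongruence (@word_congr_refl full) (@word_congr_sym full) (@word_congr_trans full)
    (@word_congr_cat full) (@word_congr_cancel full).
End IdealTheory.
End Words.

(** * The semidirect product attached to a homogeneous ideal *)

Section IdealGroup.
Import GRing.Theory.
Local Open Scope ring_scope.
Variables (p : nat) (p_prime : prime p) (m : nat) (J : ideal p m).
Implicit Types (w : word m.+1) (u v : seq nat).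

Local Notation C := (ideal_congruence p_prime J true).
Local Notation C0 := (ideal_congruence p_prime J false).
Local Notation series := (word_series p).

Definition ideal_group : groupType := word_quotient C.
Local Notation G := ideal_group.
Local Notation cl := (word_class C).

Lemma congrP w1 w2 : C w1 w2 <->
  C0 w1 w2 /\ J (fun u => series w1 (0%N :: u) - series w2 (0%N :: u)).
Proof.
split=> [/word_congrP c|[/word_congrP c0 c1]].
  by split; [apply/word_congrP => -[] // _; apply: (c false) | apply: (c true)].
by apply/word_congrP => -[] _; [|apply: (c0 false)].
Qed.

Lemma congr0P w1 w2 : C0 w1 w2 <-> J (fun u => series w1 u - series w2 u).
Proof.
split=> [/word_congrP c|c]; first exact: (c false isT).
by apply/word_congrP => -[].
Qed.

Lemma class_wordE (x : G) : cl (class_word x) = x.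
Proof. exact: class_wordK. Qed.

(** The kernel of the projection to the t-free part: the elements 1 + t b, which multiply by adding
    b. *)
Definition translations : {pred G} := fun x => C0 (class_word x) [::].

Lemma in_translations w : (cl w \in translations) = C0 w [::].
Proof.
have c0 : C0 (class_word (cl w)) w by have /congrP [] := class_word_class C w.
apply/idP/idP => [|c]; last exact: cong_trans c0 c.
by rewrite cong_sym in c0; apply: cong_trans.
Qed.

Lemma cong_inv0 w : C0 w [::] -> C0 (inv_word w) [::].
Proof.
move=> c; apply: cong_trans (cong_mulVw C0 w); rewrite cong_sym.
by have := cong_catl (inv_word w) c; rewrite cats0.
Qed.

Lemma translations_closed : group_closed translations.
Proof.
split=> [|x y]; first by rewrite -[1%g]/(cl [::]) in_translations cong_refl.
rewrite -[x]class_wordE -[y]class_wordE -word_classV -word_classM !in_translations.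
by move=> cx cy; exact: (cong_cat2 cx (cong_inv0 cy)).
Qed.

Lemma translations_normal : normal_subgroup translations.
Proof.
split=> [|x y]; first exact: translations_closed.
rewrite -[x]class_wordE -[y]class_wordE; move: (class_word x) (class_word y) => u w.
have -> : (cl u ^ cl w)%g = cl (inv_word w ++ u ++ w) by rewrite !word_classM word_classV.
rewrite !in_translations => cu; exact: cong_trans (cong_cat (inv_word w) w cu) (cong_mulVw C0 w).
Qed.

(** (a + t b)(1 + t d) has t-part b + d, because a has constant term 1 and x_i t = 0. *)
Lemma series_cat_translation w1 w2 : C0 w2 [::] ->
  J (fun u => series (w1 ++ w2) (0%N :: u) - (series w1 (0%N :: u) + series w2 (0%N :: u))).
Proof.
move=> c; elim: w1 => [|l w IH].
  by apply: ideal_ext (ideal0 J) => u _; rewrite word_series0 add0r subrr.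
have c1 : J (fun u => series (w ++ w2) u - series w u).
  by apply/congr0P; have := cong_catl w c; rewrite cats0.
have c2 : J (fun u => (0%N == l.1)%:R * (series (w ++ w2) u - series w u)).
  case: eqP => _; last by apply: ideal_ext (ideal0 J) => u _; rewrite mul0r.
  by apply: ideal_ext c1 => u _; rewrite mul1r.
apply: ideal_ext (idealD IH (ideal_sign l.2 c2)) => u _.
rewrite /= !word_series_cons //=; ring.
Qed.

Lemma translations_comm (x y : G) :
  x \in translations -> y \in translations -> (x * y = y * x)%g.
Proof.
rewrite -[x]class_wordE -[y]class_wordE -!word_classM !in_translations.
move: (class_word x) (class_word y) => u w cu cw; apply/word_classP/congrP; split.
  apply: (cong_trans (y := [::])).
    exact: (cong_cat2 cu cw).
  by rewrite cong_sym; exact: (cong_cat2 cw cu).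
apply: ideal_ext (idealB (series_cat_translation u cw) (series_cat_translation w cu)) => v _.
by rewrite [series u _ + _]addrC opprB addrA subrK.
Qed.

Lemma word_class_nseq n w : cl (flatten (nseq n w)) = (cl w ^+ n)%g.
Proof. by elim: n => //= n IH; rewrite word_classM IH expgS. Qed.

Lemma cong_nseq n w : C0 w [::] -> C0 (flatten (nseq n w)) [::].
Proof.
move=> c; elim: n => [|n IH]; first exact: cong_refl.
exact: (cong_cat2 c IH).
Qed.

Lemma translations_exp (x : G) : x \in translations -> (x ^+ p = 1)%g.
Proof.
rewrite -[x]class_wordE in_translations; move: (class_word x) => w c.
rewrite -word_class_nseq; apply/word_classP/congrP; split; first exact: cong_nseq.
have wn n : J (fun u => series (flatten (nseq n w)) (0%N :: u) - n%:R * series w (0%N :: u)).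
  elim: n => [|n IH].
    by apply: ideal_ext (ideal0 J) => u _; rewrite word_series0 mul0r subrr.
  apply: ideal_ext (idealD (series_cat_translation w (cong_nseq n c)) IH) => u _.
  by rewrite mulrS /=; ring.
apply: ideal_ext (wn p) => u _.
by rewrite natr_Fp_p // mul0r word_series0.
Qed.

Definition t_free w := all (fun l => l.1 != ord0) w.

Definition linear_part : {pred G} := fun x => `[< exists2 w, t_free w & cl w = x >].

Lemma linear_part_closed : group_closed linear_part.
Proof.
split=> [|x y]; first by apply/asboolP; exists [::].
move=> /asboolP [u fu <-] /asboolP [w fw <-]; apply/asboolP.
exists (u ++ inv_word w); last by rewrite word_classM word_classV.
rewrite /t_free all_cat; apply/andP; split=> //.
by rewrite all_rev all_map.
Qed.

Lemma series_t_free w u : t_free w -> series w (0%N :: u) = 0.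
Proof.
elim: w => [|l w IH] /=; first by rewrite word_series0.
move=> /andP[l0 fw]; rewrite word_series_cons //= IH // add0r.
by rewrite -[0%N]/(val (@ord0 m)) (inj_eq val_inj) eq_sym (negPf l0) mul0r mulr0.
Qed.

Lemma linear_part_translations (x : G) :
  x \in linear_part -> x \in translations -> x = 1%g.
Proof.
move=> /asboolP [w fw <-]; rewrite in_translations => c.
apply/word_classP/congrP; split=> //.
by apply: ideal_ext (ideal0 J) => u _; rewrite series_t_free // word_series0 subrr.
Qed.

(** A letter t never changes the t-free part of a value; deleting all of them therefore gives the
    H-component of w. *)
Lemma cong_filter w : C0 w [seq l <- w | l.1 != ord0].
Proof.
elim: w => [|l w IH]; first exact: (cong_refl C0).
rewrite [filter _ _]/=; case: ifP => [l0|/negbFE/eqP l0]; first exact: (cong_catl [:: l] IH).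
apply: cong_trans IH; apply/congr0P; apply: ideal_ext (ideal0 J) => u xu.
by rewrite word_series_cons // l0 (lmul0_xmon _ xu) mulr0 addr0 subrr.
Qed.

Lemma ideal_group_semidirect : internal_semidirect_product linear_part translations.
Proof.
split; [exact: linear_part_closed | exact: translations_normal| |exact: linear_part_translations].
move=> g; rewrite -[g]class_wordE; set w := class_word g.
set h := [seq l <- w | l.1 != ord0].
exists (cl h), ((cl h)^-1 * cl w)%g; split; last by rewrite mulVKg.
  by apply/asboolP; exists h => //; apply/allP => l; rewrite mem_filter => /andP[].
rewrite -word_classV -word_classM in_translations.
apply: cong_trans (cong_catl (inv_word h) (cong_filter w)) _.
exact: cong_mulVw.
Qed.

Definition proper_in_every_degree := forall d, exists u,
  [/\ xmon m u, size u = d & ~ J (fun v => (v == u)%:R)].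

(** Conjugating 1 + t b by 1 + x_i gives 1 + t b (1 + x_i), and dividing by 1 + t b leaves 1 + t b
    x_i. So the commutator with a generator multiplies b on the right by x_i, and every monomial is
    reached from t. *)
Lemma translation_of_monomial u : xmon m u ->
  exists2 w, C0 w [::] & J (fun v => series w (0%N :: v) - (v == u)%:R).
Proof.
elim/last_ind: u => [_|u i IH].
  exists [:: (ord0, false)].
    apply/congr0P; apply: ideal_ext (ideal0 J) => v xv.
    by rewrite word_series_cons // (lmul0_xmon _ xv) mulr0 addr0 subrr.
  apply: ideal_ext (ideal0 J) => v _.
  by rewrite word_series_cons //= !word_series0 /= add0r !mul1r subrr.
rewrite /xmon all_rcons => /andP[i0 /IH [w cw Jw]].
have ltim : (i < m.+1)%N by case/andP: i0.
pose l : letter m.+1 := (Ordinal ltim, false).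
have l0 : (0%N == l.1)%N = false by rewrite eq_sym; case/andP: i0 => /lt0n_neq0/negPf.
have c' : C0 (inv_letter l :: w ++ [:: l]) [::].
  apply: (cong_trans (y := [:: inv_letter l; l])).
    by exact: (cong_cat [:: inv_letter l] [:: l] cw).
  by rewrite -{2}[l]inv_letterK; exact: (cong_cancel C0 (inv_letter l) [::]).
exists (inv_word w ++ inv_letter l :: w ++ [:: l]).
  apply: (cong_trans (y := inv_word w)); last exact: cong_inv0.
  by have := cong_catl (inv_word w) c'; rewrite cats0.
have J1 := series_cat_translation (inv_word w) c'.
have J2 := series_cat_translation (inv_word w) cw.
have J3 : J (fun v => series (inv_word w ++ w) (0%N :: v)).
  have /congrP [_] : C (inv_word w ++ w) [::] by apply: cong_mulVw.
  by apply: ideal_ext => v _; rewrite word_series0 subr0.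
have J4 : J (fun v => rmulX i (fun v => series w (0%N :: v) - (v == u)%:R) v).
  exact: ideal_rmulX.
apply: ideal_ext (idealD (idealD J1 J4) (idealB J3 J2)) => v xv.
have -> : series (inv_letter l :: w ++ [:: l]) (0%N :: v)
    = series w (0%N :: v) + rmulX i (fun v => series w (0%N :: v)) v.
  rewrite word_series_cons //= l0 mul0r mulr0 addr0 cats1 word_series_rcons // mul1r.
  congr (_ + _); case/lastP: v {xv} => [|v j]; first by rewrite /= l0 mul0r.
  by rewrite -rcons_cons !rmulX_rcons.
have -> : rmulX i (fun v => series w (0%N :: v) - (v == u)%:R) v
    = rmulX i (fun v => series w (0%N :: v)) v - (v == rcons u i)%:R.
  case/lastP: v {xv} => [|v j]; first by case: (u); rewrite /= subr0.
  rewrite !rmulX_rcons eqseq_rcons mulrBr; congr (_ - _).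
  by case: (v == u); case: (j == i); rewrite ?mul0r ?mul1r ?mulr0.
by rewrite /=; ring.
Qed.

Hypothesis J_proper : proper_in_every_degree.

(** Translations by monomials of distinct degrees are distinct: truncating their difference at the
    smaller degree would put the smaller monomial into J. *)
Lemma translations_infinite (s : seq G) : exists2 g, g \in translations & g \notin s.
Proof.
have /choice [g gP] d : exists g : G, exists u, [/\ xmon m u, size u = d,
    ~ J (fun v => (v == u)%:R) & g \in translations /\
    exists2 w, g = cl w & J (fun v => series w (0%N :: v) - (v == u)%:R)].
  have [u [xu su nJ]] := J_proper d; have [w cw Jw] := translation_of_monomial xu.
  by exists (cl w), u; split=> //; rewrite in_translations; split=> //; exists w.
have ginj : injective g.
  suff lt d d' : g d = g d' -> ~ (d < d')%N.
    move=> d d' e; case: (ltngtP d d') => // l; first by case: (lt _ _ e).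
    by case: (lt _ _ (esym e)).
  move=> e ltd; have [u [xu su nJ [_ [w gw Jw]]]] := gP d.
  have [u' [xu' su' nJ' [_ [w' gw' Jw']]]] := gP d'.
  have /congrP [_ c] : C w w' by apply/word_classP; rewrite -gw -gw'.
  apply: nJ; have := ideal_trunc d (idealB (idealD c Jw') Jw).
  apply: ideal_ext => v _; case: leqP => [le|lt]; last first.
    by case: eqP lt => // ->; rewrite su ltnn.
  have /negPf ne : v != u' by apply: contraL ltd => /eqP ev; rewrite -leqNgt -su' -ev.
  have -> : (v == u')%:R = 0 :> 'F_p by rewrite ne.
  by ring.
have [d gd] : exists d : 'I_(size s).+1, g d \notin s.
  apply/existsP; rewrite -negb_forall; apply/negP => /forallP sub.
  have : (size (map g (iota 0 (size s).+1)) <= size s)%N.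
    apply: uniq_leq_size; first by rewrite map_inj_uniq ?iota_uniq.
    by move=> _ /mapP [d + ->]; rewrite mem_iota add0n => lt; apply: (sub (Ordinal lt)).
  by rewrite size_map size_iota ltnn.
by exists (g d) => //; have [u [_ _ _ []]] := gP d.
Qed.

Lemma ideal_group_infinite : infinite_set [set: G]%classic.
Proof.
move=> /finite_seqP [s es]; have [g _ gs] := translations_infinite s.
by have : [set: G]%classic g by []; rewrite es /= (negPf gs).
Qed.

Lemma iso_direct_sum_translations : iso_direct_sum_Zp p translations.
Proof.
apply: (@iso_direct_sum_elementary_abelian _ p_prime _ _ translations_closed
  translations_comm translations_exp (fun k => if unpickle k is Some w then cl w else 1%g)).
  by move=> g _; exists (pickle (class_word g)); rewrite pickleK class_wordE.
exact: translations_infinite.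
Qed.

Lemma ideal_group_finitely_generated : finitely_generated G.
Proof. by exists m.+1, (wq_gen C); apply: generates_wq_gen. Qed.

(** J enlarged by everything of degree above D, so that finitely many coefficients determine a
    class. Homogeneity of J makes this an ideal with the required properties. *)
Definition truncated_ideal (D : nat) : ideal p m.
Proof.
refine (@Ideal p m (fun f => J (fun u => if (size u <= D)%N then f u else 0))
          _ _ _ _ _ _ _ _).
- by move=> f g e; apply: ideal_ext => u xu; rewrite e.
- by apply: ideal_ext (ideal0 J) => u _; rewrite if_same.
- move=> f g Jf Jg; apply: ideal_ext (idealB Jf Jg) => u _.
  by case: ifP => // _; rewrite subrr.
- move=> i f i0 Jf; apply: ideal_ext (ideal_trunc D (ideal_lmulX i0 Jf)) => -[|j u] _ //=.
  by case: ltnP => // /ltnW ->.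
- move=> i f i0 Jf; apply: ideal_ext (ideal_trunc D (ideal_rmulX i0 Jf)) => -[|j u] _ //=.
  by rewrite size_belast; case: ltnP => // /ltnW ->.
- by move=> i P i0; apply: ideal_trunc; apply: ideal_square.
- by move=> f /ideal_nil.
- move=> E f Jf; apply: ideal_ext (ideal_trunc E Jf) => u _.
  by do 2 case: ifP.
Defined.

Lemma ideal_group_residually_finite : residually_finite G.
Proof.
move=> g; rewrite -[g]class_wordE; set w := class_word g => gw.
have nC : ~~ C w [::] by apply/negP => c; apply: gw; apply/word_classP.
(* The value of w has degree at most [size w], so nothing of it is lost by this truncation. *)
pose D := size w.
pose h (w' : word m.+1) : {ffun bool * (D.-bseq 'I_m.+1) -> 'F_p} :=
  [ffun x : bool * (D.-bseq 'I_m.+1) => series w' (mon_part x.1 (map val x.2))].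
apply: (@wq_finite_quotient _ C (ideal_congruence p_prime (truncated_ideal D) true) _ h).
- move=> w1 w2 /word_congrP c; apply/word_congrP => b bf.
  exact: ideal_trunc (c b bf).
- move=> w1 w2 /ffunP eh; apply/word_congrP => b _ /=.
  apply: ideal_ext (ideal0 J) => u xu; case: leqP => // leuD.
  have [u' eu'] : exists u' : seq 'I_m.+1, u = map val u'.
    elim: u xu {leuD} => [|i u IH]; first by exists [::].
    move=> /= /andP[/andP[_ ilt] /IH [u' ->]].
    by exists (Ordinal (ilt : (i < m.+1)%N) :: u').
  have leu' : (size u' <= D)%N by rewrite eu' size_map in leuD.
  have := eh (b, Bseq leu'); rewrite !ffunE /= -eu' => ->.
  by rewrite subrr.
- apply: contra nC => /word_congrP c; apply/word_congrP => b bf.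
  have /= Jc := c b bf; apply: ideal_ext Jc => u _; case: leqP => // lt.
  have size_part : (size u <= size (mon_part b u))%N by case: (b); rewrite /= ?leqnSn.
  have {lt size_part} lt := leq_trans lt size_part.
  by rewrite !word_series_size ?subrr // (leq_ltn_trans _ lt).
Qed.
End IdealGroup.

(** * The ideal generated by the relators *)

Definition monoms := seq (seq nat).

Section Polynomials.
Import GRing.Theory.
Local Open Scope ring_scope.
Variables (p : nat) (p_prime : prime p) (m : nat).
Local Notation F := 'F_p.
Implicit Types (f g : seq nat -> F) (u v : seq nat) (P Q : monoms) (a b : seq (seq nat)).

(** The computable counterpart of [mon_part] on lists of monomials. The default 1 of [head] keeps
    the empty monomial from passing as a multiple of t. *)
Definition poly_part (b : bool) P : monoms :=
  if b then [seq behead u | u <- P & (head 1%N u == 0%N) && xmon m (behead u)]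
  else [seq u <- P | xmon m u].

Lemma coefs_filter (A : pred (seq nat)) P u : coefs p (filter A P) u = (A u)%:R * coefs p P u.
Proof.
rewrite /coefs count_filter; case: (boolP (A u)) => Au; rewrite ?mul1r ?mul0r.
  by congr (_%:R); apply: eq_count => v /=; case: eqP => // ->; rewrite Au.
rewrite (eq_count (a2 := pred0)) ?count_pred0 // => v /=.
by case: eqP => // ->; rewrite (negPf Au).
Qed.

Lemma coefs_poly_part (b : bool) P u :
  coefs p (poly_part b P) u = (xmon m u)%:R * coefs p P (mon_part b u).
Proof.
case: b; last exact: coefs_filter.
rewrite -[RHS](coefs_filter (fun v => (head 1%N v == 0%N) && xmon m (behead v)) P (0%N :: u)).
rewrite /coefs /= count_map; congr (_%:R); apply: eq_in_count => v /=.
by rewrite mem_filter; case: v => [|[|i] v] //=; rewrite eqseq_cons.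
Qed.

Lemma xmon_poly_part (b : bool) P u : u \in poly_part b P -> xmon m u.
Proof.
case: b; last by rewrite mem_filter => /andP[].
by case/mapP => v; rewrite mem_filter => /andP[/andP[_ xv] _] ->.
Qed.

Lemma coefs_notin P u : u \notin P -> coefs p P u = 0.
Proof. by rewrite /coefs => /count_memPn ->. Qed.

(** Equality in the free algebra over F_p, made decidable: only the listed monomials can have
    nonzero coefficients. *)
Definition poly_eqmod P Q : bool :=
  all (fun u => count_mem u P %% p == count_mem u Q %% p)%N (P ++ Q).

Lemma eq_natr_Fp (k l : nat) : (k%:R == l%:R :> F) = (k %% p == l %% p)%N.
Proof. by rewrite -val_eqE /= !val_Fp_nat. Qed.

Lemma poly_eqmodP P Q : reflect (coefs p P =1 coefs p Q) (poly_eqmod P Q).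
Proof.
apply: (iffP allP) => [PQ u|PQ u _]; last by rewrite -eq_natr_Fp; apply/eqP/PQ.
have [/PQ|] := boolP (u \in P ++ Q); first by rewrite -eq_natr_Fp => /eqP.
by rewrite mem_cat negb_or => /andP[uP uQ]; rewrite !coefs_notin.
Qed.

Definition poly_sub P Q : monoms := P ++ flatten (nseq p.-1 Q).

Lemma coefs_poly_sub P Q u : coefs p (poly_sub P Q) u = coefs p P u - coefs p Q u.
Proof. by rewrite coefs_cat coefs_nseq natr_Fp_pred // mulN1r. Qed.

Definition poly_hom (d : nat) P : monoms := [seq u <- P | size u == d].

Definition part_diff (b : bool) (w1 w2 : seq nat) : monoms :=
  poly_sub (poly_part b (word_poly p w1)) (poly_part b (word_poly p w2)).

Definition below (d : nat) P : monoms := [seq u <- P | size u < d]%N.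

(* The index of a programme: its code, a table of words to be substituted for
   its letters, and the number of components of its output. *)
Definition index_type := (nat * (seq (seq nat) * nat))%type.
Definition arity (e : nat) : nat := (decode e : index_type).2.2.
Definition table (e : nat) : seq (seq nat) := (decode e : index_type).2.1.
Definition program (e : nat) : nat := (decode e : index_type).1.

Definition subst_word (T : seq (seq nat)) (w : seq nat) : seq nat :=
  flatten [seq nth [::] T l | l <- w].

Definition agree_below (d n : nat) (a b : seq (seq nat)) : bool :=
  all (fun k => all (fun c => poly_eqmod
        (below d (poly_part c (word_poly p (nth [::] a k))))
        (below d (poly_part c (word_poly p (nth [::] b k))))) [:: false; true]) (iota 0 n).

(** Only the steps i and j have to differ, not the words written there; this keeps the relation
    semi-decidable and still suffices to contradict a sequence of pairwise different elements. *)
Definition output_pair (e : nat) (ab : seq (seq nat) * seq (seq nat)) : Prop :=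
  exists i j ca cb : nat, (i != j) /\ yields (program e) [:: i] ca /\
    yields (program e) [:: j] cb /\
    ab.1 = [seq subst_word (table e) w | w <- decode ca] /\
    ab.2 = [seq subst_word (table e) w | w <- decode cb] /\
    agree_below e.+2 (arity e) ab.1 ab.2.

(** The code of a pair bounds its second entry. Thus the number of relators that programme e adds in
    one degree is bounded in terms of e. *)
Lemma arity_leq e : (arity e <= e)%N.
Proof.
have snd_le (A B : Type) (eA : encoding A) (eB : encoding B) k :
    (behead_code k <= k)%N.
  by have [->|/behead_code_lt/ltnW] := eqVneq k 0%N.
rewrite /arity /= /decode_pair /=.
exact: leq_trans (snd_le _ _ nat_encoding nat_encoding _) (snd_le _ _ nat_encoding nat_encoding _).
Qed.

Variable sel : nat -> seq (seq nat) * seq (seq nat) -> Prop.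

(** The degree is carried along because the component q may be zero, and an empty list does not
    determine it. *)
Definition relator (d : nat) (q : monoms) : Prop :=
  (exists i, (0 < i <= m)%N /\ d = 2%N /\ q = [:: [:: i; i]]) \/
  (exists e ab k c, sel e ab /\ (k < arity e)%N /\ (e.+2 <= d)%N /\
     q = poly_hom d (part_diff c (nth [::] ab.1 k) (nth [::] ab.2 k))).

Lemma relator_deg d q : relator d q -> (1 < d)%N.
Proof. by case=> [[i [_ [-> _]]]|[e [ab [k [c [_ [_ [lt _]]]]]]]] //; apply: leq_trans lt. Qed.

Lemma relator_hom d q u : relator d q -> u \in q -> size u = d.
Proof.
case=> [[i [_ [-> ->]]]|[e [ab [k [c [_ [_ [_ ->]]]]]]]].
  by rewrite inE => /eqP->.
by rewrite mem_filter => /andP[/eqP].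
Qed.

Lemma relator_xmon d q u : relator d q -> u \in q -> xmon m u.
Proof.
case=> [[i [i0 [_ ->]]]|[e [ab [k [c [_ [_ [_ ->]]]]]]]].
  by rewrite inE => /eqP->; rewrite /xmon /= i0.
rewrite mem_filter mem_cat => /andP[_ /orP[/xmon_poly_part //|/flattenP[Q]]].
by rewrite mem_nseq => /andP[_ /eqP->] /xmon_poly_part.
Qed.

(* A term (u, (d, q), v) stands for the product of the monomial u, the relator q
   of degree d, and the monomial v. *)
Definition term_type := (seq nat * (nat * monoms) * seq nat)%type.

Definition term_poly (x : term_type) : monoms :=
  [seq x.1.1 ++ (y ++ x.2) | y <- x.1.2.2].

Definition combination (s : seq term_type) : monoms := flatten (map term_poly s).

Definition term_valid (x : term_type) : Prop :=
  xmon m x.1.1 /\ xmon m x.2 /\ relator x.1.2.1 x.1.2.2.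

Definition term_deg (x : term_type) : nat := (size x.1.1 + (x.1.2.1 + size x.2))%N.

(** Scalars are absorbed by repetition: a coefficient in F_p is a number of copies, so lists of
    terms give all elements of the ideal. *)
Definition relator_ideal f : Prop :=
  exists2 s : seq term_type, (forall x, x \in s -> term_valid x)
    & forall u, xmon m u -> f u = coefs p (combination s) u.

Lemma combination_cat s s' : combination (s ++ s') = combination s ++ combination s'.
Proof. by rewrite /combination map_cat flatten_cat. Qed.

Lemma combination_nseq k s :
  combination (flatten (nseq k s)) = flatten (nseq k (combination s)).
Proof. by elim: k => //= k IH; rewrite combination_cat IH. Qed.

Lemma combination_map (h : term_type -> term_type) (c : seq nat -> seq nat) s :
  (forall x, term_poly (h x) = map c (term_poly x)) ->
  combination (map h s) = map c (combination s).
Proof. by move=> hc; rewrite /combination map_flatten -!map_comp; congr flatten; apply: eq_map. Qed.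

Lemma term_poly_size x u : term_valid x -> u \in term_poly x -> size u = term_deg x.
Proof.
by move=> [_ [_ rel]] /mapP [y /(relator_hom rel) sy ->]; rewrite !size_cat sy.
Qed.

Lemma coefs_map_rcons i P u : coefs p (map (rcons^~ i) P) u = rmulX i (coefs p P) u.
Proof.
case/lastP: u => [|u j].
  rewrite /coefs count_map (eq_count (a2 := pred0)) ?count_pred0 // => v /=.
  by case: v.
rewrite rmulX_rcons /coefs count_map; case: eqVneq => [->|ne]; rewrite ?mul1r ?mul0r.
  by congr (_%:R); apply: eq_count => v /=; rewrite eqseq_rcons eqxx andbT.
rewrite (eq_count (a2 := pred0)) ?count_pred0 // => v /=.
by rewrite eqseq_rcons eq_sym (eq_sym i) (negPf ne) andbF.
Qed.

Definition ideal_of_relators : ideal p m.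
Proof.
refine (@Ideal p m relator_ideal _ _ _ _ _ _ _ _).
- by move=> f g fg [s sv fs]; exists s => // u xu; rewrite -fg // fs.
- by exists [::] => // u _; rewrite /coefs.
- move=> f g [s sv fs] [s' sv' gs'].
  exists (s ++ flatten (nseq p.-1 s')) => [x|u xu].
    rewrite mem_cat => /orP[/sv //|/flattenP[s'']].
    by rewrite mem_nseq => /andP[_ /eqP->] /sv'.
  by rewrite combination_cat combination_nseq coefs_poly_sub fs ?gs'.
- move=> i f i0 [s sv fs]; pose h (x : term_type) : term_type := ((i :: x.1.1, x.1.2), x.2).
  exists (map h s) => [_ /mapP [x /sv [xu [xv rx]] ->]|u xu].
    by split; rewrite /= ?i0.
  rewrite (combination_map (c := cons i)) => [|x]; last first.
    by rewrite /term_poly -map_comp.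
  rewrite coefs_map_cons; case: u xu => [|j u] //= /andP[_ xu].
  by rewrite fs.
- move=> i f i0 [s sv fs]; pose h (x : term_type) : term_type := (x.1, rcons x.2 i).
  exists (map h s) => [_ /mapP [x /sv [xu [xv rx]] ->]|u xu].
    by split=> //=; split=> //=; rewrite /xmon all_rcons i0.
  rewrite (combination_map (c := rcons^~ i)) => [|x]; last first.
    by rewrite /term_poly -map_comp; apply: eq_map => y /=; rewrite !rcons_cat.
  rewrite coefs_map_rcons; case/lastP: u xu => [|u j] // xu.
  rewrite !rmulX_rcons fs //.
  by move: xu; rewrite /xmon all_rcons => /andP[].
- move=> i P i0; pose h (v : seq nat) : term_type := ([::], (2%N, [:: [:: i; i]]), v).
  exists (map h [seq v <- P | xmon m v]) => [_ /mapP [v + ->]|u xu].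
    by rewrite mem_filter => /andP[xv _]; split=> //; split=> //; left; exists i.
  have -> : combination (map h [seq v <- P | xmon m v])
      = map (cons i) (map (cons i) [seq v <- P | xmon m v]).
    by rewrite /combination; elim: [seq v <- P | xmon m v] => //= v s ->.
  rewrite coefs_map_cons (eq_lmulX _ (coefs_map_cons p i _)).
  case: u xu => [|j [|k u]] //= /and3P[_ _ xu].
  by rewrite coefs_filter /= xu mul1r.
(* Relators have degree at least 2, so no term reaches the empty monomial. *)
- move=> f [s sv fs]; rewrite fs // coefs_notin //; apply/negP.
  case/flattenP => _ /mapP [x /sv xv ->] /(term_poly_size xv) /= e.
  case: xv => _ [_ /relator_deg]; rewrite /term_deg in e; lia.
(* Every term is homogeneous, as the relators are, so truncating the sum amounts to discarding the
   terms of degree above D. *)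
- move=> D f [s sv fs].
  exists [seq x <- s | term_deg x <= D]%N => [x|u xu].
    by rewrite mem_filter => /andP[_ /sv].
  have -> : combination [seq x <- s | term_deg x <= D]%N
      = [seq u <- combination s | size u <= D]%N.
    elim: s sv {fs} => //= x s IH sv; rewrite /combination /= filter_cat -/(combination s).
    rewrite -IH => [|y ys]; last by apply: sv; rewrite inE ys orbT.
    have xv := sv x (mem_head x s).
    have -> : [seq u <- term_poly x | size u <= D]%N
        = if (term_deg x <= D)%N then term_poly x else [::].
      case: ifP => dx; [apply/all_filterP/allP => v|apply/eqP; rewrite -[_ == _]negbK -has_filter; apply/hasP => -[v]];
        by move/(term_poly_size xv) => ->; rewrite ?dx.
    by case: ifP.
  by rewrite coefs_filter -fs //; case: ifP; rewrite ?mul1r ?mul0r.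
Defined.
End Polynomials.

(** * Computability of the operations on polynomials *)

Section PolynomialComputability.
Variables (p : nat) (p_prime : prime p) (m : nat).
Context {A : Type} {eA : encoding A}.

Lemma computable_xmon (f : A -> seq nat) :
  computable f -> computable (fun x => xmon m (f x)).
Proof. by move=> cf; rewrite /xmon; computability. Qed.

Lemma computable_word_poly (f : A -> seq nat) :
  computable f -> computable (fun x => word_poly p (f x)).
Proof. by move=> cf; rewrite /word_poly /letter_poly; computability. Qed.

Lemma computable_below (d : A -> nat) (f : A -> monoms) :
  computable d -> computable f -> computable (fun x => below (d x) (f x)).
Proof.
move=> cd cf; rewrite /below; computability.
by apply: (computable_comp cd); computability.
Qed.

Lemma computable_poly_hom (d : A -> nat) (f : A -> monoms) :
  computable d -> computable f -> computable (fun x => poly_hom (d x) (f x)).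
Proof.
move=> cd cf; rewrite /poly_hom; computability.
by apply: (computable_comp cd); computability.
Qed.

Lemma computable_poly_sub (f g : A -> monoms) :
  computable f -> computable g -> computable (fun x => poly_sub p (f x) (g x)).
Proof. by move=> cf cg; rewrite /poly_sub; computability. Qed.

Lemma computable_subst_word (T : A -> seq (seq nat)) (f : A -> seq nat) :
  computable T -> computable f -> computable (fun x => subst_word (T x) (f x)).
Proof.
move=> cT cf; rewrite /subst_word; computability.
by apply: (computable_comp cT); computability.
Qed.

Lemma computable_poly_eqmod (f g : A -> monoms) :
  computable f -> computable g -> computable (fun x => poly_eqmod p (f x) (g x)).
Proof.
move=> cf cg; rewrite /poly_eqmod; computability; rewrite ?prime_gt0 //.
all: by [apply: (computable_comp cf); computability | apply: (computable_comp cg); computability].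
Qed.
End PolynomialComputability.

Lemma computable_poly_part {A} {eA : encoding A}
    (m : nat) (b : A -> bool) (f : A -> monoms) :
  computable b -> computable f -> computable (fun x => poly_part m (b x) (f x)).
Proof.
move=> cb cf; rewrite /poly_part; computability; apply: computable_xmon; computability.
Qed.

Lemma computable_agree_below {A} {eA : encoding A} (p : nat) (p_prime : prime p) (m : nat)
    (d n : A -> nat) (a b : A -> seq (seq nat)) :
  computable d -> computable n -> computable a -> computable b ->
  computable (fun x => agree_below p m (d x) (n x) (a x) (b x)).
Proof.
move=> cd cn ca cb; rewrite /agree_below; computability.
apply: computable_poly_eqmod => //; apply: computable_below.
all: try by apply: (computable_comp cd); computability.
all: apply: computable_poly_part; first by computability.
all: apply: computable_word_poly; computability.
  by apply: (computable_comp ca); computability.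
by apply: (computable_comp cb); computability.
Qed.

Lemma computable_index : computable (fun e : nat => decode e : index_type).
Proof. exact: (computable_decode computable_id). Qed.

Lemma computable_arity : computable arity.
Proof. by have cd := computable_index; rewrite /arity; computability. Qed.

Lemma computable_table : computable table.
Proof. by have cd := computable_index; rewrite /table; computability. Qed.

Lemma computable_program : computable program.
Proof. by have cd := computable_index; rewrite /program; computability. Qed.

Lemma semidecidable_output_pair (p : nat) (p_prime : prime p) (m : nat) :
  semidecidable (fun x : nat * (seq (seq nat) * seq (seq nat)) => output_pair p m x.1 x.2).
Proof.
rewrite /output_pair; do 4 apply: semidecidable_ex.
have cp (B : Type) (eB : encoding B) (f : B -> nat) : computable f ->
  computable (fun x => program (f x)) by apply: computable_comp computable_program.
have ct (B : Type) (eB : encoding B) (f : B -> nat) : computable f ->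
  computable (fun x => table (f x)) by apply: computable_comp computable_table.
have sy (B : Type) (eB : encoding B) (e y : B -> nat) (v : B -> seq nat) :
    computable e -> computable v -> computable y ->
    semidecidable (fun x => yields (e x) (v x) (y x)).
  move=> ce cv cy.
  apply: (semidecidable_comp semidecidable_yields (f := fun x => (e x, v x, y x))).
  by computability.
apply: semidecidable_and; first by semidecidability.
apply: semidecidable_and; first by apply: sy; computability; apply: cp; computability.
apply: semidecidable_and; first by apply: sy; computability; apply: cp; computability.
apply: semidecidable_and.
  semidecidability; apply: computable_subst_word; computability.
  by apply: ct; computability.
apply: semidecidable_and.
  semidecidability; apply: computable_subst_word; computability.
  by apply: ct; computability.
apply: semidecidable_bool; apply: computable_agree_below => //; computability.
by apply: (computable_comp computable_arity); computability.
Qed.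

(** * Enumerability of the relators and of the trivial words *)

Section RelatorSemidecidability.
Variables (p : nat) (p_prime : prime p) (m : nat).
Variable sel : nat -> seq (seq nat) * seq (seq nat) -> Prop.
Hypothesis sel_semidecidable :
  semidecidable (fun x : nat * (seq (seq nat) * seq (seq nat)) => sel x.1 x.2).

Lemma semidecidable_relator :
  semidecidable (fun x : nat * monoms => relator p m sel x.1 x.2).
Proof.
rewrite /relator; apply: semidecidable_or; first by semidecidability.
do 4 apply: semidecidable_ex.
apply: semidecidable_and.
  apply: (semidecidable_comp sel_semidecidable
    (f := fun x : nat * monoms * nat * (seq (seq nat) * seq (seq nat)) * nat * bool =>
            (x.1.1.1.2, x.1.1.2))).
  by computability.
apply: semidecidable_and.
  semidecidability.
  by apply: (computable_comp computable_arity); computability.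
semidecidability.
apply: computable_poly_hom; computability.
apply: computable_poly_sub; apply: computable_poly_part; computability;
  by apply: computable_word_poly; computability.
Qed.

Lemma semidecidable_term_valid : semidecidable (term_valid p m sel).
Proof.
rewrite /term_valid; apply: semidecidable_and.
  by semidecidability; apply: computable_xmon; computability.
apply: semidecidable_and.
  by semidecidability; apply: computable_xmon; computability.
apply: (semidecidable_comp semidecidable_relator (f := fun x : term_type => x.1.2)).
by computability.
Qed.

(* Membership of the value of w minus 1 in the ideal, witnessed by a list of terms. *)
Definition trivial_word (w : seq nat) : Prop :=
  forall c, c \in [:: false; true] -> exists s : seq term_type,
    (forall x, x \in s -> term_valid p m sel x) /\
    poly_eqmod p (poly_part m c (word_poly p w))
                 (poly_part m c [:: [::]] ++ combination s).

Lemma semidecidable_trivial_word : semidecidable trivial_word.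
Proof.
rewrite /trivial_word; apply: semidecidable_all; last by computability.
apply: semidecidable_ex; apply: semidecidable_and.
  apply: semidecidable_all; last by computability.
  apply: (semidecidable_comp semidecidable_term_valid
    (f := fun x : seq nat * bool * seq term_type * term_type => x.2)).
  by computability.
apply: semidecidable_bool; apply: computable_poly_eqmod => //.
  by apply: computable_poly_part; computability; apply: computable_word_poly; computability.
apply: computable_cat; first by apply: computable_poly_part; computability.
by rewrite /combination /term_poly; computability.
Qed.

Lemma trivial_wordP (w : word m.+1) :
  ideal_congruence p_prime (ideal_of_relators p_prime m sel) true w [::] <->
  trivial_word (map (@letter_code m.+1) w).
Proof.
split=> [/word_congrP c b _|triv].
  have [s sv fs] := c b (implybT b); exists s; split=> //; apply/poly_eqmodP => // u.
  rewrite coefs_cat !coefs_poly_part; case: (boolP (xmon m u)) => xu; last first.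
    rewrite !GRing.mul0r GRing.add0r coefs_notin //; apply: contra xu.
    case/flattenP => _ /mapP [x /sv [xl [xr rx]] ->] /mapP [y yq ->].
    by rewrite /xmon !all_cat -!/(xmon m _) xl xr (relator_xmon rx yq).
  rewrite !GRing.mul1r -fs //; rewrite /word_series /=.
  by rewrite GRing.addrC GRing.subrK.
apply/word_congrP => b _; have [|s [sv /poly_eqmodP e]] := triv b; first by case: b.
exists s => // u xu; have := e p_prime u.
rewrite coefs_cat !coefs_poly_part xu !GRing.mul1r /word_series => -> /=.
by rewrite GRing.addrC GRing.addKr.
Qed.

Lemma recursively_enumerable_ideal_congruence : recursively_enumerable (fun w : word m.+1 =>
  ideal_congruence p_prime (ideal_of_relators p_prime m sel) true w [::]).
Proof.
have [f fP] := semidecidable_recursively_enumerable m.+1 semidecidable_trivial_word.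
by exists f => w; rewrite -fP; apply: trivial_wordP.
Qed.

(* Above degree e + 1 all homogeneous components of the difference are relators. *)
Lemma sel_congruent e ab k (w1 w2 : word m.+1) :
    sel e ab -> k < arity e -> agree_below p m e.+2 (arity e) ab.1 ab.2 ->
    nth [::] ab.1 k = map (@letter_code m.+1) w1 ->
    nth [::] ab.2 k = map (@letter_code m.+1) w2 ->
  ideal_congruence p_prime (ideal_of_relators p_prime m sel) true w1 w2.
Proof.
move=> se ltk agr e1 e2; apply/word_congrP => b _.
pose q d := poly_hom d (part_diff p m b (nth [::] ab.1 k) (nth [::] ab.2 k)).
pose t d : term_type := ([::], (d, q d), [::]).
(* N bounds the degrees of both values, so the N components from degree e + 2 on exhaust the
   difference; below degree e + 2 it vanishes by agreement. *)
pose N := size w1 + size w2.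
have tq d : term_poly (t d) = q d.
  by rewrite /term_poly /= -[RHS]map_id; apply: eq_map => v; rewrite cats0.
exists (map t (iota e.+2 N)) => [_ /mapP [d + ->]|u xu].
  rewrite mem_iota => /andP[led _]; split=> //; split=> //; right.
  by exists e, ab, k, b.
pose f v := (word_series p w1 (mon_part b v) - word_series p w2 (mon_part b v))%R.
rewrite -[LHS]/(f u).
have qu d : coefs p (q d) u = ((size u == d)%:R * f u)%R.
  rewrite coefs_filter; congr (_ * _)%R.
  by rewrite coefs_poly_sub // !coefs_poly_part xu !GRing.mul1r e1 e2.
have -> r : coefs p (combination (map t r)) u = ((count_mem (size u) r)%:R * f u)%R.
  elim: r => [|d r IH]; first by rewrite GRing.mul0r.
  rewrite /combination /= coefs_cat tq qu -/(combination _) IH GRing.natrD GRing.mulrDl.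
  by rewrite eq_sym.
rewrite count_uniq_mem ?iota_uniq // mem_iota.
have [ltu|leu] := ltnP (size u) e.+2.
  rewrite GRing.mul0r.
  have /allP/(_ k) := agr; rewrite mem_iota add0n => /(_ ltk) /allP /(_ b).
  have bm : b \in [:: false; true] by case: (b).
  move=> /(_ bm) /poly_eqmodP /(_ u); rewrite !coefs_filter ltu !GRing.mul1r.
  rewrite !coefs_poly_part xu !GRing.mul1r e1 e2 => eu.
  by rewrite /f /word_series eu // GRing.subrr.
have [lt|ge] := ltnP (size u) (e.+2 + N); first by rewrite GRing.mul1r.
rewrite GRing.mul0r /f.
have su : size u <= size (mon_part b u) by case: (b); rewrite /= ?leqnSn.
by rewrite !word_series_size ?GRing.subrr //; apply: leq_trans su; rewrite /N in ge; lia.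
Qed.
End RelatorSemidecidability.

(** * The Golod-Shafarevich inequality *)

(* The invariant is b (d + 1) >= 4 b d together with
   V d <= 4 b d, where V collects the relators of degree at least 3. *)
Lemma golod_shafarevich_growth (b r : nat -> nat) :
    0 < b 0 -> r 0 = 0 -> r 1 = 0 -> r 2 <= 8 -> (forall i, r i.+3 <= 2 ^ i.+3) ->
    (forall d, 8 * b d <= b d.+1 + \sum_(i < d.+2) r i * b (d.+1 - i)) ->
  forall d, 0 < b d.
Proof.
move=> b0 r0 r1 r2 r3 gs.
(* With r replaced by its bound 2^i, the sum is a convolution with a geometric sequence and so obeys
   a first-order recursion. *)
pose V d := \sum_(i < d) 2 ^ i.+3 * b (d.-1 - i).
have VS d : V d.+1 = 8 * b d + 2 * V d.
  rewrite /V big_ord_recl /= subn0 big_distrr /=; congr (_ + _).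
  apply: eq_bigr => i _; rewrite mulnA -expnS; congr (_ * b _).
  by rewrite /bump /=; case: d i => [[]|d i] //=.
have le d : 8 * b d.+1 <= b d.+2 + (8 * b d + V d).
  apply: leq_trans (gs d.+1) _; rewrite leq_add2l !big_ord_recl /= r0 r1 !mul0n !add0n.
  apply: leq_add; first by rewrite /bump /= subn2 /= leq_mul2r r2 orbT.
  apply: leq_sum => i _; rewrite /bump /= !add1n; apply: leq_mul; first exact: r3.
  by case: d i => [[]|d i].
(* From 8 b d <= 2 b (d + 1) and V d <= 4 b d <= b (d + 1) follows b (d + 2) >= (8 - 2 - 1) b (d +
   1), and V (d + 1) = 8 b d + 2 V d <= 4 b (d + 1). *)
have inv d : (4 * b d <= b d.+1) && (V d <= 4 * b d) && (0 < b d).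
  elim: d => [|d /andP[/andP[IH1 IH2] IH3]].
    rewrite b0 /V big_ord0 /= andbT.
    have := gs 0; rewrite !big_ord_recl big_ord0 /= r0 r1; lia.
  have := le d; have := VS d; lia.
by move=> d; case/andP: (inv d).
Qed.

Section GolodShafarevich.
Import GRing.Theory.
Local Open Scope ring_scope.
Variables (p : nat) (p_prime : prime p) (m : nat) (rels : nat -> seq monoms).
Local Notation F := 'F_p.
Implicit Types (f g r : seq nat -> F).

(** The shift by one leaves 0 for the module generator t. *)
Definition mon (t : seq 'I_m) : seq nat := [seq (val i).+1 | i <- t].

Definition hom_space (d : nat) := {ffun d.-tuple 'I_m -> F^o}.

Definition hom_part (d : nat) f : hom_space d := [ffun t : d.-tuple 'I_m => f (mon t)].

Definition shift_fun (x : 'I_m) d (g : hom_space d) : hom_space d.+1 :=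
  [ffun t : d.+1.-tuple 'I_m => (thead t == x)%:R * g (behead_tuple t)].

Fact shift_fun_linear x d : linear (@shift_fun x d).
Proof. by move=> a g h; apply/ffunP => t; rewrite !ffunE mulrDr mulrCA. Qed.

HB.instance Definition _ x d := GRing.isLinear.Build F (hom_space d) (hom_space d.+1) _
  (@shift_fun x d) (@shift_fun_linear x d).

Definition shift x d : 'Hom(hom_space d, hom_space d.+1) := linfun (@shift_fun x d).

(** Left multiplication by the degree-i part of r. Keeping j independent of d avoids casts between
    tuple types; the default 0 occurs only when j differs from d - i. *)
Definition conv_fun r i j d (g : hom_space j) : hom_space d :=
  [ffun t : d.-tuple 'I_m => r (mon (take i t)) *
     (if insub (drop i t : seq 'I_m) is Some s then g s else 0)].

Fact conv_fun_linear r i j d : linear (@conv_fun r i j d).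
Proof.
move=> a g h; apply/ffunP => t; rewrite !ffunE.
case: insubP => [s _ _|_]; first by rewrite !ffunE mulrDr mulrCA.
by rewrite !mulr0 addr0 [_ *: _]mulr0.
Qed.

HB.instance Definition _ r i j d := GRing.isLinear.Build F (hom_space j) (hom_space d) _
  (@conv_fun r i j d) (@conv_fun_linear r i j d).

Definition conv r i j d : 'Hom(hom_space j, hom_space d) := linfun (@conv_fun r i j d).

Definition conv_series r i g : seq nat -> F := fun u => r (take i u) * g (drop i u).

(** The recursion I = X I + R A, with X the span of the letters and R that of the relators: a
    product u q v starts either with a letter of u or with the relator q. *)
Fixpoint ideal_space (d : nat) : {vspace hom_space d} :=
  match d with
  | 0 => 0%VS
  | d'.+1 => (\sum_(x < m) (shift x d' @: ideal_space d') +
      \sum_(i < d'.+2) \sum_(k < size (rels i))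
        limg (conv (coefs p (nth [::] (rels i) k)) i (d'.+1 - i) d'.+1))%VS
  end.

Lemma mon_inj : injective mon.
Proof. by apply: inj_map => i j [] /val_inj. Qed.

Lemma hom_part_surj d (g : hom_space d) : exists f, g = hom_part d f.
Proof.
exists (fun u => \sum_(t : d.-tuple 'I_m) g t * (u == mon t)%:R).
apply/ffunP => t; rewrite ffunE (bigD1 t) //= eqxx mulr1 big1 ?addr0 // => s st.
by rewrite (inj_eq mon_inj) val_eqE eq_sym (negPf st) mulr0.
Qed.

Lemma shift_hom_part x d f : shift x d (hom_part d f) = hom_part d.+1 (lmulX x.+1 f).
Proof.
rewrite lfunE; apply/ffunP => t; rewrite !ffunE; case/tupleP: t => y t.
by rewrite theadE /= eqSS val_eqE; congr (_ * f (mon _)).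
Qed.

Lemma conv_hom_part r i j d g : d = (i + j)%N ->
  conv r i j d (hom_part j g) = hom_part d (conv_series r i g).
Proof.
move=> ed; rewrite lfunE; apply/ffunP => t; rewrite !ffunE /conv_series.
rewrite /mon map_take; congr (_ * _).
case: insubP => [s _ es|/negP[]]; first by rewrite ffunE -map_drop -es.
by rewrite size_drop size_tuple ed addKn.
Qed.

Lemma conv_series_split r i j g : hom_part (i.+1 + j) (conv_series r i.+1 g) =
  \sum_(x < m) shift x (i + j) (hom_part (i + j) (conv_series (fun u => r (x.+1 :: u)) i g)).
Proof.
apply/ffunP => t; rewrite sum_ffunE ffunE; case/tupleP: t => y t.
rewrite (bigD1 y) //= lfunE ffunE theadE eqxx mul1r ffunE big1 ?addr0 => [|x xy].
  by congr (_ * _).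
by rewrite lfunE ffunE theadE eq_sym (negPf xy) mul0r.
Qed.

Lemma conv_series_shifts r i j g :
    (forall r', hom_part (i + j) (conv_series r' i g) \in ideal_space (i + j)) ->
  hom_part (i.+1 + j) (conv_series r i.+1 g) \in
    (\sum_(x < m) (shift x (i + j) @: ideal_space (i + j)))%VS.
Proof. by move=> gI; rewrite conv_series_split memv_sumr // => x _; apply: memv_img. Qed.

Lemma conv_series_in r i j g : hom_part j g \in ideal_space j ->
  hom_part (i + j) (conv_series r i g) \in ideal_space (i + j).
Proof.
move=> gI; elim: i r => [|i IH] r.
  have -> : hom_part (0 + j) (conv_series r 0 g) = r [::] *: hom_part j g.
    by apply/ffunP => t; rewrite !ffunE /conv_series take0 drop0.
  exact: memvZ.
exact: (subvP (addvSl _ _) _ (conv_series_shifts r IH)).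
Qed.

Lemma dim_hom_space d : dim (hom_space d) = (m ^ d)%N.
Proof. by rewrite -[LHS]/(#|{: d.-tuple 'I_m}| * 1)%N muln1 card_tuple card_ord. Qed.

Definition codim d : nat := (m ^ d - \dim (ideal_space d))%N.

Lemma codimE d : (codim d + \dim (ideal_space d) = m ^ d)%N.
Proof. by rewrite subnK // -dim_hom_space -dimvf dimvS ?subvf. Qed.

Lemma dim_limg (aT rT : vectType F) (f : 'Hom(aT, rT)) U : (\dim (f @: U) <= \dim U)%N.
Proof. by rewrite -(limg_ker_dim f U) leq_addl. Qed.

Hypothesis rels0 : rels 0 = [::].

(** The heart of the inequality. Relators have positive degree, so R I lies in X I; hence in R A the
    factor A may be replaced by a complement of I, whose dimension is the codimension of I. *)
Lemma ideal_space_split d : (ideal_space d.+1 <=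
  \sum_(x < m) (shift x d @: ideal_space d) + \sum_(i < d.+2) \sum_(k < size (rels i))
    (conv (coefs p (nth [::] (rels i) k)) i (d.+1 - i) d.+1 @: (ideal_space (d.+1 - i))^C))%VS.
Proof.
rewrite [X in (X <= _)%VS]/= subv_add addvSl /=; apply/subv_sumP => i _; apply/subv_sumP => k _.
rewrite -(addv_complf (ideal_space (d.+1 - i))) limgD subv_add; apply/andP; split; last first.
  apply: subv_trans (addvSr _ _); apply: (sumv_sup i) => //.
  exact: (sumv_sup k).
apply: subv_trans (addvSl _ _); apply/subvP => _ /memv_imgP [g gI ->].
have i_gt0 : (0 < i)%N.
  rewrite lt0n; apply/eqP => i0.
  by have := leq_ltn_trans (leq0n k) (ltn_ord k); rewrite i0 rels0.
have [f fg] := hom_part_surj g; rewrite {g}fg in gI *.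
move: gI; move: (coefs p _) => r; move: (nat_of_ord i) (ltn_ord i) i_gt0 => {k}{}i lti.
case: i lti => // i lti _ gI.
have ed : d = (i + (d.+1 - i.+1))%N by rewrite subSS subnKC.
rewrite conv_hom_part; last by rewrite subnKC // ltnW.
move: (d.+1 - i.+1)%N ed gI => j ed; rewrite {d lti}ed => gI.
exact: (conv_series_shifts _ (fun r' => conv_series_in r' i gI)).
Qed.

Lemma golod_shafarevich d : (m * codim d <= codim d.+1 +
  \sum_(i < d.+2) size (rels i) * codim (d.+1 - i))%N.
Proof.
have := dimvS (ideal_space_split d).
set S1 := (\sum_(x < m) _)%VS; set S2 := (\sum_(i < d.+2) _)%VS => le12.
have le1 : (\dim S1 <= m * \dim (ideal_space d))%N.
  apply: leq_trans (dimv_leq_sum _ _ _) _.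
  rewrite -[X in (_ <= X * _)%N](card_ord m) -sum_nat_const.
  by apply: leq_sum => x _; apply: dim_limg.
have le2 : (\dim S2 <= \sum_(i < d.+2) size (rels i) * codim (d.+1 - i))%N.
  apply: leq_trans (dimv_leq_sum _ _ _) _; apply: leq_sum => i _.
  apply: leq_trans (dimv_leq_sum _ _ _) _.
  rewrite -[X in (_ <= X * _)%N](card_ord (size (rels i))) -sum_nat_const.
  apply: leq_sum => k _; apply: leq_trans (dim_limg _ _) _.
  by rewrite dimv_compl dimvf dim_hom_space.
have le3 := leq_trans le12 (leq_trans (dimv_add_leqif S1 S2).1 (leq_add le1 le2)).
(* Substituting m^k minus the codimension for each dimension of I turns the bound on dimensions into
   the claim. *)
have := codimE d; have := codimE d.+1; rewrite expnS; nia.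
Qed.

Hypothesis rels_hom : forall i q u, q \in rels i -> u \in q -> size u = i.

Lemma mon_xmon t : xmon m (mon t).
Proof. by apply/allP => _ /mapP [i _ ->] /=. Qed.

Lemma eq_hom_part d f g : (forall u, xmon m u -> size u = d -> f u = g u) ->
  hom_part d f = hom_part d g.
Proof.
by move=> fg; apply/ffunP => t; rewrite !ffunE fg ?mon_xmon // size_map size_tuple.
Qed.

Lemma hom_part0 d f : (forall u, size u = d -> f u = 0) -> hom_part d f = 0.
Proof. by move=> f0; apply/ffunP => t; rewrite !ffunE f0 // size_map size_tuple. Qed.

Lemma hom_part_add d f g : hom_part d (fun u => f u + g u) = hom_part d f + hom_part d g.
Proof. by apply/ffunP => t; rewrite !ffunE. Qed.

Lemma ideal_space_relator i q v d : q \in rels i ->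
  hom_part d (coefs p [seq y ++ v | y <- q]) \in ideal_space d.
Proof.
move=> qi; have i_gt0 : (0 < i)%N by case: i qi => //; rewrite rels0.
have [ed|ne] := eqVneq d (i + size v)%N; last first.
  rewrite hom_part0 ?mem0v // => u su; apply: coefs_notin; apply/mapP => -[y yq eu].
  by rewrite eu size_cat (rels_hom qi yq) in su; rewrite su eqxx in ne.
(* The product of q and v is the monomial v multiplied by q on the left, hence lies in the range of
   one of the [conv] summands. *)
have -> : hom_part d (coefs p [seq y ++ v | y <- q])
    = conv (coefs p q) i (d - i) d (hom_part (d - i) (fun u => (u == v)%:R)).
  rewrite conv_hom_part; last by rewrite ed addKn.
  apply: eq_hom_part => u _ su; rewrite /conv_series /coefs count_map.
  case: eqVneq => [ev|nv]; rewrite ?mulr1 ?mulr0; last first.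
    rewrite (eq_in_count (a2 := pred0)) ?count_pred0 // => y yq /=; apply/eqP => eu.
    by rewrite -eu -(rels_hom qi yq) drop_size_cat ?eqxx in nv.
  congr (_%:R); apply: eq_in_count => y yq /=.
  rewrite -{1}(cat_take_drop i u) ev eqseq_cat ?eqxx ?andbT //.
  by rewrite (rels_hom qi yq) size_takel // su ed leq_addr.
case: d ed => [|d] ed; first by move: i_gt0; rewrite lt0n; case: (i) ed.
have lti : (i < d.+2)%N by rewrite ltnS ed leq_addr.
have ltk : (index q (rels i) < size (rels i))%N by rewrite index_mem.
apply: subvP (addvSr _ _) _ _.
apply: subvP (sumv_sup (Ordinal lti) _ (subvv _)) _ _ => //.
apply: subvP (sumv_sup (Ordinal ltk) _ (subvv _)) _ _ => //=.
by rewrite nth_index // memv_img // memvf.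
Qed.

Lemma ideal_space_lmul u P : xmon m u ->
    (forall d, hom_part d (coefs p P) \in ideal_space d) ->
  forall d, hom_part d (coefs p (map (cat u) P)) \in ideal_space d.
Proof.
elim: u => [_ PI d|[|i] u IH] //; first by rewrite map_id.
move=> /= /andP[ltim xu] PI d.
have -> : map (cat (i.+1 :: u)) P = map (cons i.+1) (map (cat u) P).
  by rewrite -map_comp.
rewrite (eq_hom_part (g := lmulX i.+1 (coefs p (map (cat u) P)))); last first.
  by move=> v _ _; rewrite coefs_map_cons.
case: d => [|d]; first by rewrite hom_part0 ?mem0v // => -[].
rewrite -(shift_hom_part (Ordinal ltim)); apply: subvP (addvSl _ _) _ _.
apply: subvP (sumv_sup (Ordinal ltim) _ (subvv _)) _ _ => //.
exact/memv_img/IH.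
Qed.
End GolodShafarevich.

(** * Counting relators: the ideal is proper in every degree *)

Section Properness.
Import GRing.Theory.
Local Open Scope ring_scope.
Variables (p : nat) (p_prime : prime p).
Variable sel : nat -> seq (seq nat) * seq (seq nat) -> Prop.
Hypothesis sel_inj : forall e ab ab', sel e ab -> sel e ab' -> ab = ab'.

(** Only the length matters here, so the pair is taken by classical choice; uniqueness of the
    selected pair ensures that no relator of programme e is missed. *)
Definition index_relators (d e : nat) : seq monoms :=
  if pselect (exists ab, sel e ab) is left ex then
    let ab := projT1 (cid ex) in
    [seq poly_hom d (part_diff p 8 c (nth [::] ab.1 k) (nth [::] ab.2 k))
       | k <- iota 0 (arity e), c <- [:: false; true]]
  else [::].

(** The range e < d - 1 is the condition e + 2 <= d. *)
Definition relators (d : nat) : seq monoms :=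
  (if d == 2%N then [seq [:: [:: i; i]] | i <- iota 1 8] else [::])
  ++ flatten [seq index_relators d e | e <- iota 0 d.-1].

Lemma mem_relators d q : relator p 8 sel d q -> q \in relators d.
Proof.
rewrite mem_cat => -[[i [i0 [-> ->]]]|[e [ab [k [c [se [lt [led ->]]]]]]]].
  by apply/orP; left; rewrite eqxx; apply/mapP; exists i; rewrite ?mem_iota.
apply/orP; right; apply/flattenP; exists (index_relators d e).
  by rewrite map_f // mem_iota add0n; case: d led.
rewrite /index_relators; case: pselect => [ex|[]]; last by exists ab.
case: cid => ab' se'; rewrite [projT1 _]/= (sel_inj se' se) {ab' se'}.
by apply/allpairsPdep; exists k, c; rewrite mem_iota add0n lt; case: c.
Qed.

Lemma relators_hom d q u : q \in relators d -> u \in q -> size u = d.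
Proof.
rewrite mem_cat => /orP[|/flattenP [_ /mapP [e _ ->]]].
  by case: eqP => // -> /mapP [i _ ->]; rewrite inE => /eqP->.
rewrite /index_relators; case: pselect => // ex /allpairsPdep [k [c [_ _ ->]]].
by rewrite mem_filter => /andP[/eqP].
Qed.

Lemma size_index_relators d e : (size (index_relators d e) <= 2 * e)%N.
Proof.
rewrite /index_relators; case: pselect => // ex.
by rewrite size_allpairs size_iota mulnC leq_mul2l arity_leq.
Qed.

Lemma size_relators d :
  (size (relators d) <= (d == 2%N) * 8 + d.-1 * d.-2)%N.
Proof.
rewrite size_cat leq_add //; first by case: eqP.
rewrite size_flatten /shape -map_comp sumnE big_map.
elim: d.-1 => [|k IH]; first by rewrite big_nil.
rewrite -[X in iota 0 X]addn1 iotaD big_cat big_seq1 add0n.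
apply: leq_trans (leq_add IH (size_index_relators _ _)) _.
by case: (k) => //= n; nia.
Qed.

Lemma ideal_space_proper d : (0 < @codim p 8 relators d)%N.
Proof.
(* In degree i + 3 the count (d - 1)(d - 2) is (i + 2)(i + 1); with k = i + 1 this gives the bound
   2^(i + 3) demanded by the growth lemma. *)
have pronic k : (k.+1 * k <= 2 ^ k.+2)%N.
  elim: k => // k IH; rewrite expnS.
  have : (k.+1 < 2 ^ k.+1)%N by apply: ltn_expl.
  rewrite !expnS in IH *; nia.
apply: (golod_shafarevich_growth (r := fun i => size (relators i))).
- by rewrite /codim /= dimv0.
- by [].
- by apply/eqP; rewrite -leqn0 (leq_trans (size_relators 1)).
(* In degree 2 only programme 0 could contribute, but its arity is 0, which leaves the eight
   squares. *)
- exact: (leq_trans (size_relators 2)).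
- move=> i; apply: leq_trans (size_relators i.+3) _.
  rewrite mul0n add0n /=; apply: leq_trans (pronic i.+1) _.
  by [].
- exact: golod_shafarevich.
Qed.

Lemma ideal_of_relators_space f d :
  ideal_of_relators p_prime 8 sel f -> @hom_part p 8 d f \in @ideal_space p 8 relators d.
Proof.
move=> [s sv fs]; rewrite (eq_hom_part (g := coefs p (combination s))); last first.
  by move=> u xu _; apply: fs.
elim: s sv {fs} => [|x s IH] sv; first by rewrite hom_part0 ?mem0v.
rewrite (eq_hom_part (g := fun u => coefs p (term_poly x) u + coefs p (combination s) u)).
  rewrite hom_part_add rpredD //; last by apply: IH => y ys; apply: sv; rewrite inE ys orbT.
  have [xu [_ /mem_relators rx]] := sv x (mem_head x s).
  rewrite /term_poly (_ : map _ _ = map (cat x.1.1) [seq y ++ x.2 | y <- x.1.2.2]).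
    apply: ideal_space_lmul => // d'; apply: ideal_space_relator rx => //.
    exact: relators_hom.
  by rewrite -map_comp.
by move=> u _ _; rewrite -coefs_cat.
Qed.

(** If all monomials of degree d were in the ideal, its degree-d part would be the whole space,
    against positive codimension. *)
Lemma ideal_of_relators_proper : proper_in_every_degree (ideal_of_relators p_prime 8 sel).
Proof.
move=> d; have [[t nJ]|all_in] := pselect (exists t : d.-tuple 'I_8,
    ~ ideal_of_relators p_prime 8 sel (fun v => (v == mon t)%:R)).
  by exists (mon t); rewrite mon_xmon size_map size_tuple.
have := ideal_space_proper d; rewrite subn_gt0 ltnNge -(dim_hom_space p) -dimvf => /negP[].
apply: dimvS; apply/subvP => g _.
have -> : g = \sum_(t : d.-tuple 'I_8) g t *: @hom_part p 8 d (fun v => (v == mon t)%:R).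
  apply/ffunP => t; rewrite sum_ffunE (bigD1 t) //= big1 ?addr0 => [|s st].
    by rewrite !ffunE eqxx [_ *: _]mulr1.
  by rewrite !ffunE (inj_eq (@mon_inj 8)) val_eqE eq_sym (negPf st) [_ *: _]mulr0.
apply: rpred_sum => t _; apply: rpredZ; apply: ideal_of_relators_space.
by apply: contrapT => nJ; apply: all_in; exists t.
Qed.
End Properness.

(** * Algorithmic finiteness *)

Lemma finite_type_collision (T : finType) (c : nat -> T) : exists i j, i != j /\ c i = c j.
Proof.
apply: contrapT => no.
have inj : injective c by move=> i j e; apply/eqP/negPn/negP => ne; apply: no; exists i, j.
have : size (map c (iota 0 #|T|.+1)) <= #|T|.
  have /card_uniqP <- : uniq (map c (iota 0 #|T|.+1)) by rewrite map_inj_uniq ?iota_uniq.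
  exact: max_card.
by rewrite size_map size_iota ltnn.
Qed.

Definition index_of (c : nat) (T : seq (seq nat)) (n : nat) : nat := encode (c, (T, n)).

Lemma decode_index_of c T n : decode (index_of c T n) = (c, (T, n)) :> index_type.
Proof. exact: encodeK. Qed.

Lemma arity_index_of c T n : arity (index_of c T n) = n.
Proof. by rewrite /arity decode_index_of. Qed.

Lemma table_index_of c T n : table (index_of c T n) = T.
Proof. by rewrite /table decode_index_of. Qed.

Lemma program_index_of c T n : program (index_of c T n) = c.
Proof. by rewrite /program decode_index_of. Qed.

Section AlgorithmicFiniteness.
Variables (p : nat) (p_prime : prime p) (m : nat).
Variable sel : nat -> seq (seq nat) * seq (seq nat) -> Prop.
Hypothesis sel_sub : forall e ab, sel e ab -> output_pair p m e ab.
Hypothesis sel_total : forall e ab, output_pair p m e ab -> exists ab', sel e ab'.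

Local Notation C := (ideal_congruence p_prime (ideal_of_relators p_prime m sel) true).
Local Notation G := (word_quotient C).
Local Notation codes := (map (@letter_code m.+1)).

Section Substitution.
Variables (k : nat) (x : 'I_k -> G).

Definition letter_word (l : letter k) : word m.+1 :=
  if l.2 then inv_word (class_word (x l.1)) else class_word (x l.1).

Definition subst_letters (w : word k) : word m.+1 := flatten (map letter_word w).

(** All that an index has to record about the generating family x: for each letter code a word in
    the standard generators that represents the letter. *)
Definition letter_table : seq (seq nat) :=
  mkseq (fun c => if insub c./2 is Some i then codes (letter_word (i, odd c)) else [::]) k.*2.

Lemma nth_letter_table l : nth [::] letter_table (letter_code l) = codes (letter_word l).
Proof.
case: l => i b; rewrite nth_mkseq /letter_code /=; last first.
  by have := ltn_ord i; case: b; lia.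
rewrite addnC half_bit_double oddD odd_double addbF oddb.
by case: insubP => [j _ /val_inj -> //|]; rewrite ltn_ord.
Qed.

Lemma subst_word_letters (w : word k) :
  subst_word letter_table (map (@letter_code k) w) = codes (subst_letters w).
Proof.
rewrite /subst_word /subst_letters map_flatten -!map_comp; congr flatten.
by apply: eq_map => l; apply: nth_letter_table.
Qed.

Lemma word_val_subst (w : word k) : word_val x w = word_class C (subst_letters w).
Proof.
elim: w => [|l w IH]; first by rewrite /word_val big_nil.
rewrite /word_val big_cons -/(word_val _ _) IH /subst_letters /= word_classM.
congr mul; rewrite /letter_word; case: l.2; last by rewrite class_wordK.
by rewrite word_classV class_wordK.
Qed.
End Substitution.

Lemma decode_words_code k n (t : n.-tuple (word k)) :
  (decode (words_code t) : seq (seq nat)) = [seq map (@letter_code k) w | w <- t].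
Proof.
rewrite /= /decode_seq /words_code CodeSeq.codeK -map_comp; apply: eq_map => w /=.
by rewrite /decode_seq CodeSeq.codeK map_id.
Qed.

(** Totality and the pigeonhole principle show that some pair exists. The selected pair may be
    another one, but it too comes from two different steps, and the relators identify its two
    values. *)
Lemma power_algorithmically_finite_ideal_quotient n : power_algorithmically_finite G n.
Proof.
move=> k x _ [f [s [fs sdiff]]].
pose e := index_of (prog_code f) (letter_table x) n.
have ar : arity e = n := arity_index_of _ _ _.
have tb : table e = letter_table x := table_index_of _ _ _.
have pr : program e = prog_code f := program_index_of _ _ _.
pose out i : seq (seq nat) := [seq codes (subst_letters x w) | w <- s i].
have outE i : out i = [seq subst_word (table e) w | w <- (decode (words_code (s i)) : seq (seq nat))].
  rewrite decode_words_code -map_comp tb; apply: eq_map => w /=.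
  by rewrite subst_word_letters.
have nth_out i (c : 'I_n) : nth [::] (out i) c = codes (subst_letters x (tnth (s i) c)).
  by rewrite (nth_map [::]) ?size_tuple // (tnth_nth [::]).
pose D := e.+2.
(* The coefficients at monomials of bounded length in all components and both parts: finitely many
   possibilities, so two steps must agree. *)
pose h i : {ffun 'I_n * bool * (D.-bseq 'I_m.+1) -> 'F_p} :=
  [ffun y : 'I_n * bool * (D.-bseq 'I_m.+1) =>
     word_series p (subst_letters x (tnth (s i) y.1.1)) (mon_part y.1.2 (map val y.2))].
have [i [j [ij hij]]] := finite_type_collision h.
have agr : agree_below p m e.+2 (arity e) (out i) (out j).
  apply/allP => c; rewrite mem_iota add0n ar => ltcn; apply/allP => b _.
  apply/poly_eqmodP => // u; rewrite !coefs_filter !coefs_poly_part.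
  case: (ltnP (size u) e.+2) => [ltu|]; last by rewrite !GRing.mul0r.
  case: (boolP (xmon m u)) => xu; last by rewrite !GRing.mul0r.
  have [u' eu'] : exists u' : seq 'I_m.+1, u = map val u'.
    elim: u xu {ltu} => [|l u IH]; first by exists [::].
    move=> /= /andP[/andP[_ ilt] /IH [u' ->]].
    by exists (Ordinal (ilt : (l < m.+1)%N) :: u').
  have leu' : size u' <= D by rewrite eu' size_map in ltu; apply: ltnW.
  have /ffunP /(_ (Ordinal ltcn, b, Bseq leu')) := hij; rewrite !ffunE /= -eu'.
  by rewrite (nth_out i (Ordinal ltcn)) (nth_out j (Ordinal ltcn)) /word_series => ->.
have op : output_pair p m e (out i, out j).
  exists i, j, (words_code (s i)), (words_code (s j)); rewrite -!outE pr.
  by split=> //; split; [apply/yieldsP|split; [apply/yieldsP|]].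
have [[a b] sab] := sel_total op.
have [i' [j' [ca [cb [ij' [yi [yj [ea [eb agr']]]]]]]]] := sel_sub sab.
rewrite pr in yi yj; move: yi yj => /yieldsP yi /yieldsP yj.
(* Programmes are deterministic, so the selected outputs are the tuples that s lists at i' and
   j'. *)
rewrite (computes_inj yi (fs i')) -outE in ea; rewrite (computes_inj yj (fs j')) -outE in eb.
case: (sdiff i' j' (elimN eqP ij')); apply/ffunP => c; rewrite !ffunE !word_val_subst.
apply/word_classP; apply: (sel_congruent p_prime (k := c) sab _ agr'); rewrite ?ar //.
  by rewrite ea nth_out.
by rewrite eb nth_out.
Qed.
End AlgorithmicFiniteness.

Theorem mainTheorem1 (p : nat) (p_prime : prime p) :
  (exists G : groupType, infinite_rp_rf_powers_alg_finite G) /\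
  (exists G : groupType,
     infinite_rp_rf_powers_alg_finite G /\
     exists N H : {pred G},
       [/\ normal_subgroup N, iso_direct_sum_Zp p N & internal_semidirect_product H N]).
Proof.
(* The pairs depend on p and the free algebra alone, so they can be selected before the ideal is
   formed. *)
have [sel [sel_sd sel_sub sel_inj sel_total]] :=
  semidecidable_uniformization (semidecidable_output_pair p_prime 8).
pose J := ideal_of_relators p_prime 8 sel.
have Jproper : proper_in_every_degree J := ideal_of_relators_proper p_prime sel_inj.
suff main : infinite_rp_rf_powers_alg_finite (ideal_group p_prime J).
  split; exists (ideal_group p_prime J) => //; split=> //.
  exists (@translations p p_prime 8 J), (@linear_part p p_prime 8 J); split.
  - exact: translations_normal.
  - exact: iso_direct_sum_translations.
  - exact: ideal_group_semidirect.
split.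
- exact: ideal_group_infinite.
- exact: ideal_group_finitely_generated.
- exact/wq_recursively_presented/recursively_enumerable_ideal_congruence.
- exact: ideal_group_residually_finite.
- by move=> n _; apply: power_algorithmically_finite_ideal_quotient.
Qed.
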